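(* The $k$-DMLOT problem is fixed parameter tractable for (all) digraphs: there is an algorithm which, given a digraph $D$ of order $n$ and a positive integer $k$, decides whether $\ell(D)\ge k$ in time $f(k)\, n^{O(1)}$ for some computable function $f$ depending only on $k$.
   Context: Digraphs are finite, without loops or parallel arcs. An out-tree of a digraph $D$ is a subdigraph $T$ that is an oriented tree with exactly one vertex of in-degree zero (the root); its leaves are its vertices of out-degree zero. $\ell(D)$ denotes the maximum number of leaves of an out-tree of $D$. The $k$-DMLOT problem: given a digraph $D$ and a positive integer parameter $k$, decide whether $\ell(D)\ge k$. *)

(* Defs.v *)
From HB Require Import structures.
From mathcomp Require Import all_boot.

Set Implicit Arguments.
Unset Strict Implicit.
Unset Printing Implicit Defensive.

(** * Digraphs and out-trees *)

(* A relation excludes parallel arcs; arcs in both directions between two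
   vertices are allowed. *)
Record digraph := Digraph {
  vertex :> finType;
  arc : rel vertex;
  arc_irrefl : irreflexive arc
}.

Section OutTree.
Variable D : digraph.

(* Vertex set and arc set of a candidate subdigraph. *)
Definition subpair := ({set D} * {set D * D})%type.

Implicit Types (T : subpair) (x y : D).

Definition subdigraph T :=
  [forall x, forall y, ((x, y) \in T.2) ==> [&& x \in T.1, y \in T.1 & arc x y]].

Definition uadj T : rel D := [rel x y | ((x, y) \in T.2) || ((y, x) \in T.2)].

Definition oriented T :=
  [forall x, forall y, ((x, y) \in T.2) ==> ((y, x) \notin T.2)].

Definition uconnected T :=
  (T.1 != set0) && [forall x in T.1, forall y in T.1, connect (uadj T) x y].

(* No cycle of length at least 3 in the underlying undirected graph.  Cycles
   have pairwise distinct vertices, hence length at most #|D|, so that the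
   quantification can be bounded: see uacyclicP. *)
Definition uacyclic T :=
  [forall m : 'I_#|D|.+1, forall p : m.-tuple D,
     (2 < m) ==> ~~ ucycleb (uadj T) p].

Lemma uacyclicP T :
  reflect (forall p : seq D, 2 < size p -> ~ ucycle (uadj T) p) (uacyclic T).
Proof.
apply: (iffP forallP) => [acT p p_gt2 cyc_p | acT m].
  have p_le : size p < #|D|.+1.
    by have /andP[_ /card_uniqP <-] := cyc_p; rewrite ltnS max_card.
  have /forallP/(_ (in_tuple p)) := acT (Ordinal p_le).
  by rewrite /= p_gt2 /=; apply/negP/negPn.
apply/forallP=> p; apply/implyP=> m_gt2; apply/negP.
by apply: acT; rewrite size_tuple.
Qed.

Definition oriented_tree T := [&& oriented T, uconnected T & uacyclic T].

Definition sources T := [set x in T.1 | [forall y, (y, x) \notin T.2]].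

Definition leaves T := [set x in T.1 | [forall y, (x, y) \notin T.2]].

Definition out_tree T :=
  [&& subdigraph T, oriented_tree T & #|sources T| == 1].

Definition ell : nat := \max_(T : subpair | out_tree T) #|leaves T|.

End OutTree.

(** * Random access machines

   The registers hold natural numbers of arbitrary size and every instruction
   has unit cost.  The only arithmetic operations are addition, truncated
   subtraction and halving, so this cost measure is polynomially related to
   Turing machine time. *)

Inductive instr :=
  | IConst of nat & nat        (* r_i := c *)
  | IMove of nat & nat         (* r_i := r_j *)
  | IAdd of nat & nat & nat    (* r_i := r_j + r_l *)
  | ISub of nat & nat & nat    (* r_i := r_j - r_l, or 0 if r_j < r_l *)
  | IHalf of nat & nat         (* r_i := floor (r_j / 2) *)
  | ILoad of nat & nat         (* r_i := r_(r_j) *)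
  | IStore of nat & nat        (* r_(r_i) := r_j *)
  | IJump of nat               (* continue at address a *)
  | IJumpZ of nat & nat        (* continue at address a if r_i = 0 *)
  | IHalt.

Definition program := seq instr.

Definition memory := nat -> nat.

Definition upd (m : memory) (i v : nat) : memory :=
  fun j => if j == i then v else m j.

(* Program counter and memory. *)
Definition config := (nat * memory)%type.

(* Control running past the last instruction also halts the machine. *)
Definition fetch (P : program) (s : config) : instr := nth IHalt P s.1.

Definition halted (P : program) (s : config) : bool :=
  if fetch P s is IHalt then true else false.

(* Halted configurations are fixed points of [step]. *)
Definition step (P : program) (s : config) : config :=
  let: (pc, m) := s in
  match fetch P s with
  | IConst i c => (pc.+1, upd m i c)
  | IMove i j => (pc.+1, upd m i (m j))
  | IAdd i j l => (pc.+1, upd m i (m j + m l))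
  | ISub i j l => (pc.+1, upd m i (m j - m l))
  | IHalf i j => (pc.+1, upd m i (m j)./2)
  | ILoad i j => (pc.+1, upd m i (m (m j)))
  | IStore i j => (pc.+1, upd m (m i) (m j))
  | IJump a => (a, m)
  | IJumpZ i a => (if m i == 0 then a else pc.+1, m)
  | IHalt => s
  end.

(* The input word occupies the first registers, all others being 0. *)
Definition init (w : seq nat) : config := (0, nth 0 w).

(* On input [w], [P] halts after at most [t] steps with [v] in register 0. *)
Definition outputs_within (P : program) (w : seq nat) (t v : nat) : Prop :=
  let s := iter t (step P) (init w) in halted P s /\ s.2 0 = v.

Definition computable (f : nat -> nat) : Prop :=
  exists P : program, forall k, exists t, outputs_within P [:: k] t (f k).

(* The parameter, the order, and the rows of the adjacency matrix with respect
   to the enumeration of the vertices. *)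
Definition encode (D : digraph) (k : nat) : seq nat :=
  [:: k, #|D| & [seq nat_of_bool (arc x y) | x <- enum D, y <- enum D]].

(* Main.v *)
From mathcomp Require Import all_boot zify.
Require Import Defs.

Set Implicit Arguments.
Unset Strict Implicit.
Unset Printing Implicit Defensive.

(** Branching algorithm (after Kneis, Langer and Rossmanith).  Guess the root
    of the out-tree and grow a tree from it, whose inner vertices have all their
    out-neighbours in the tree.  For an undecided leaf [x], one bit tells
    whether [x] stays a leaf or becomes inner, in which case all its
    out-neighbours outside the tree become leaves.  If [x] has at most one such
    out-neighbour [y], then making [x] inner is only useful when [y] becomes
    inner too: otherwise [x] can replace [y] as a leaf.  So [y] is expanded
    without spending a bit.  Hence each bit either settles a leaf for good or
    creates a new one, [2 k] bits are enough to reach [k] leaves, and trying the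
    [4 ^ k] guesses for every root takes time [O(16 ^ k n ^ 3)]. *)

(** * Out-trees *)

(** Soundness carries an actual out-tree along, but completeness follows only a set [J] of inner
    vertices connected from the root. A tree with inner set [J] can have all out-neighbours of [J]
    outside [J] as leaves, so the exchange argument is an inequality between sizes of boundaries,
    and no tree is ever rebuilt. The bound [2 k] on the bits comes from a potential in which a leaf
    counts once, and twice when it is settled. Of the two factors [4 ^ k] in the running time, one
    counts guesses; the other absorbs the [2 k + n] steps of a trial, since [2 k + n <= 4 ^ k * n]
    for positive [n]. On the machine, the obstacle is the input. It fills the registers from 0 on up
    to a length depending on [n], so no register at a fixed address is known to be free. For the
    same reason the matrix and the statuses, both of unbounded length, are interleaved by parity
    rather than stored one after the other. *)

Section OutTrees.
Variable D : digraph.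
Implicit Types (T : subpair D) (x y r : D).

Lemma out_tree1 r : out_tree ([set r], set0 : {set D * D}).
Proof.
apply/and3P; split.
- by apply/forallP=> x; apply/forallP=> y; rewrite inE.
- apply/and3P; split.
  + by apply/forallP=> x; apply/forallP=> y; rewrite inE.
  + apply/andP; split; first by apply/set0Pn; exists r; rewrite inE.
    apply/forallP=> x; apply/implyP=> /set1P->; apply/forallP=> y.
    by apply/implyP=> /set1P->; rewrite connect0.
  + apply/uacyclicP=> -[|x [|y p]] //= _ /andP[/= /andP[]].
    by rewrite /uadj /= !inE.
- rewrite (_ : sources _ = [set r]) ?cards1 //; apply/setP=> x.
  rewrite !inE; case: eqP => //= _; apply/forallP=> y; by rewrite inE.
Qed.

(** In the new underlying graph [y] is pendant: its only neighbour is [x]. A cycle of length at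
    least 3 through [y] would thus meet [x] twice, right after and right before [y]; any other cycle
    is already one of [T]. *)
Lemma out_tree_add T x y :
    out_tree T -> x \in T.1 -> y \notin T.1 -> arc x y ->
  out_tree (y |: T.1, (x, y) |: T.2).
Proof.
move=> /and3P[subT /and3P[orT /andP[_ conT] acT] srcT] xT yT xy.
have T2 u v : (u, v) \in T.2 -> [&& u \in T.1, v \in T.1 & arc u v].
  by move: subT => /forallP/(_ u)/forallP/(_ v)/implyP.
have ne_xy : (x == y) = false by apply: contraNF yT => /eqP<-.
have T2yl u : (y, u) \in T.2 = false.
  by apply: contraNF yT => /T2/and3P[].
have T2yr u : (u, y) \in T.2 = false.
  by apply: contraNF yT => /T2/and3P[].
set T' := (_, _).
have adj u v : u != y -> v != y -> uadj T' u v = uadj T u v.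
  move=> uy vy; rewrite /uadj /= !inE /= !xpair_eqE (negPf uy) (negPf vy).
  by rewrite !andbF.
have adjy u : uadj T' y u -> u = x.
  rewrite /uadj /= !inE /= !xpair_eqE eqxx T2yl T2yr !orbF andbT eq_sym ne_xy.
  by move/eqP.
have adj_sym : symmetric (uadj T') by move=> u v; rewrite /uadj /= orbC.
apply/and3P; split.
- apply/forallP=> u; apply/forallP=> v; apply/implyP; rewrite !inE /=.
  case/predU1P=> [[-> ->]|/T2/and3P[-> -> ->]]; last by rewrite !orbT.
  by rewrite eqxx xT xy orbT.
- apply/and3P; split.
  + apply/forallP=> u; apply/forallP=> v; apply/implyP; rewrite !inE /=.
    case/predU1P=> [[-> ->]|uv]; rewrite xpair_eqE.
      by rewrite T2yl eq_sym ne_xy.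
    move: orT => /forallP/(_ u)/forallP/(_ v)/implyP/(_ uv)/negPf->.
    by rewrite orbF negb_and orbC; apply/orP; left;
      apply: contraTneq uv => ->; rewrite T2yl.
  + apply/andP; split; first by apply/set0Pn; exists y; rewrite !inE eqxx.
    have con u : u \in T'.1 -> connect (uadj T') x u.
      rewrite !inE => /predU1P[->|uT].
        by apply: connect1; rewrite /uadj /= !inE eqxx.
      move: conT => /forallP/(_ x); rewrite xT => /forallP/(_ u).
      rewrite uT /=; apply: connect_sub => a b ab; apply: connect1.
      by move: ab; rewrite /uadj /= !inE => /orP[]->; rewrite !orbT.
    apply/forallP=> u; apply/implyP=> /con xu; apply/forallP=> v.
    apply/implyP=> /con; apply: connect_trans.
    by rewrite (sym_connect_sym adj_sym).
  + apply/uacyclicP=> p p_gt2 cyc; have [yp|yp] := boolP (y \in p).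
      have [i q Eq] := rot_to yp; move: cyc p_gt2.
      rewrite -(rot_ucycle i) -(size_rot i) Eq.
      case: q {Eq} => [|a [|b q]] //= /andP[/= /and3P[ya ab bq]].
      case/and3P=> _ abq _.
      move: bq ya; rewrite rcons_path => /andP[_].
      rewrite adj_sym => /adjy lx /adjy ax.
      by move: abq; rewrite ax -lx mem_last.
    move/uacyclicP: acT => /(_ p p_gt2); apply.
    case/andP: cyc => cyc Up; apply/andP; split=> //.
    rewrite -(@eq_in_cycle _ (predC1 y) (uadj T')) //.
    by apply/allP=> z zp; apply: contraNneq yp => <-.
- suff -> : sources T' = sources T by [].
  apply/setP=> z; rewrite !inE /=.
  have [->|zy] /= := eqVneq z y.
    rewrite (negPf yT) /=; apply/negP=> /forallP/(_ x).
    by rewrite !inE eqxx.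
  congr (_ && _); apply: eq_forallb => u.
  by rewrite !inE xpair_eqE (negPf zy) andbF.
Qed.
(** The clause on arcs ensures that no vertex other than [x] stops being a leaf. *)
Lemma out_tree_grow T x s :
    out_tree T -> x \in T.1 -> uniq s ->
    {in s, forall y, arc x y && (y \notin T.1)} ->
  exists T', [/\ out_tree T', T'.1 = T.1 :|: [set y in s] &
    forall u v, (u, v) \in T'.2 -> u = x \/ (u, v) \in T.2].
Proof.
elim: s => [|y s IH] treeT xT /= => [_ _|/andP[ys Us] sP].
  by exists T; split=> // [|u v uv]; [apply/setP=> u;
    rewrite !inE orbF | right].
have [//|//|//|z zs|T' [treeT' T1' T2']] := IH.
  by apply: sP; rewrite inE zs orbT.
have /andP[xy yT] := sP y (mem_head y s).
exists (y |: T'.1, (x, y) |: T'.2); split=> /= [||u v].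
- by apply: out_tree_add; rewrite // T1' !inE ?xT // negb_or yT.
- by rewrite T1'; apply/setP=> u; rewrite !inE orbCA.
by rewrite !inE => /predU1P[[-> _]|/T2']; [left|].
Qed.

(** The last clause is induction along arcs from the root. If it failed for [S], moving from a
    vertex outside [S] to its parent would never leave the complement of [S], and by finiteness
    would close a directed cycle. *)
Lemma out_tree_root T : out_tree T ->
  exists r, [/\ r \in T.1,
    {in T.1, forall v, v != r -> exists u, (u, v) \in T.2} &
    forall S : {set D}, r \in S ->
      (forall u v, u \in S -> (u, v) \in T.2 -> v \in S) -> T.1 \subset S].
Proof.
move=> /and3P[subT /and3P[orT _ acT] /cards1P[r srcT]].
have T2 u v : (u, v) \in T.2 -> u \in T.1.
  by move: subT => /forallP/(_ u)/forallP/(_ v)/implyP h /h /and3P[].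
have asym u v : (u, v) \in T.2 -> (v, u) \notin T.2.
  by move: orT => /forallP/(_ u)/forallP/(_ v)/implyP.
have par v : v \in T.1 -> v != r -> exists u, (u, v) \in T.2.
  rewrite -in_set1 -srcT inE => -> /=; rewrite negb_forall.
  by case/existsP=> u /negPn uv; exists u.
exists r; split=> // [|S rS Sarc].
  by have := set11 r; rewrite -srcT inE => /andP[].
apply/subsetP=> v0 v0T; apply/negPn/negP=> v0S.
(* The parent map. Its default value is never taken on [C], whose vertices differ from the root
   because [r] is in [S]. *)
pose f z := odflt z [pick u | (u, z) \in T.2].
pose C := T.1 :\: S.
have fC z : z \in C -> ((f z, z) \in T.2) && (f z \in C).
  rewrite inE => /andP[zS zT]; rewrite /f; case: pickP => [u uz|noz] /=.
    rewrite uz inE (T2 _ _ uz) andbT /=.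
    by apply: contra zS => uS; apply: Sarc uz.
  have [|u] := par z zT; last by rewrite noz.
  by apply: contraNneq zS => ->.
have iC i z : z \in C -> iter i f z \in C.
  by move=> zC; elim: i => //= i /fC/andP[].
have v0C : v0 \in C by rewrite inE v0S.
have /loopingP/(_ (order f v0))/trajectP[i lt_i Ei] := looping_order f v0.
set x := iter i f v0 in Ei; have xC : x \in C by apply: iC.
have cyc : fcycle f (orbit f x).
  apply/(orbitPcycle 3 0); exists (order f v0 - i).-1.
  by rewrite prednK ?subn_gt0 // /x -iterD subnK ?Ei // ltnW.
have oC : all (mem C) (orbit f x).
  apply/allP=> z; rewrite -fconnect_orbit => /iter_findex <-; exact: iC.
have ucyc : ucycle (uadj T) (orbit f x).
  rewrite /ucycle /ucycleb orbit_uniq andbT.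
  apply: sub_in_cycle oC cyc => u v uC _ /eqP <-.
  by rewrite /uadj /= (andP (fC u uC)).1 orbT.
move/uacyclicP: acT => /(_ (orbit f x)) /(_ _ ucyc); apply.
have: x \in orbit f x by rewrite -fconnect_orbit.
(* Acyclicity only speaks of length at least 3; orbits of size 1 and 2 would be a loop and a pair of
   opposite arcs, which [oriented] excludes. *)
case: (orbit f x) cyc oC => [|a [|b [|c p]]] //=.
  rewrite andbT => /eqP fa /andP[/fC/andP[]]; rewrite fa => aa.
  by have := asym _ _ aa; rewrite aa.
case/and3P=> /eqP fa /eqP fb _ /and3P[/fC/andP[]]; rewrite fa => ba _.
by move=> /fC/andP[]; rewrite fb => ab; have := asym _ _ ab; rewrite ba.
Qed.

Lemma leq_ell T k : out_tree T -> k <= #|leaves T| -> k <= ell D.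
Proof. by move=> tT kT; apply: (bigmax_sup T). Qed.

(** Positivity of [k] excludes the empty digraph, where [ell] is the value 0 of an empty maximum and
    no tree exists. *)
Lemma ell_geP k : 0 < k -> k <= ell D ->
  exists2 T : subpair D, out_tree T & k <= #|leaves T|.
Proof.
move=> k_gt0 le_k; have [T0 tT0|noT] := pickP (@out_tree D).
  have [|T tT eT] := @eq_bigmax_cond _ (@out_tree D) (fun T => #|leaves T|).
    by apply/card_gt0P; exists T0.
  by exists T => //; rewrite -eT; apply: le_k.
by move: le_k; rewrite /ell big_pred0 // leqNgt k_gt0.
Qed.

End OutTrees.

(** * The branching algorithm *)

Section Branching.
Variable D : digraph.
Implicit Types (st : D -> nat) (x y u v r : D) (J S : {set D}).

(* Status of a vertex: 0 outside the tree grown so far, 1 undecided leaf,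
   2 leaf that must stay a leaf, 3 inner vertex, 4 leaf that must become an
   inner vertex. *)
Definition set_status st x c : D -> nat := fun y => if y == x then c else st y.

Definition init_status r : D -> nat := set_status (fun=> 0) r 1.

Definition fresh st x : pred D := [pred y | arc x y & st y == 0].

Definition child_status d := if d == 1 then 4 else 1.

Definition expand st x : D -> nat :=
  set_status
    (fun y => if fresh st x y then child_status #|fresh st x| else st y) x 3.

(* The bits of the guess [s.2] decide on the undecided leaves. *)
Definition branch (s : (D -> nat) * nat) : (D -> nat) * nat :=
  if [pick x | s.1 x == 4] is Some x then (expand s.1 x, s.2)
  else if [pick x | s.1 x == 1] is Some x then
    (set_status s.1 x (if odd s.2 then 4 else 2), s.2./2)
  else s.

(** Status 4 counts: such a vertex is bound to become inner, but no arc of the current tree leaves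
    it yet. *)
Definition leaf_status c := (c != 0) && (c != 3).

Definition nleaves st := #|[pred v | leaf_status (st v)]|.

(** Each effective step spends a bit or makes one more vertex inner, whence [k + k + #|D|] steps.
    Steps after the last meaningful bit read zeros, which do no harm. *)
Definition accepts k r g :=
  k <= nleaves (iter (k + k + #|D|) branch (init_status r, g)).1.

(** Arcs start at inner vertices, but an inner vertex may have no arc in [T], when it was expanded
    without fresh out-neighbours. So [nleaves st] is only a lower bound on the leaves of [T], which
    is the direction soundness needs. *)
Definition tree_inv st := exists T : subpair D, [/\ out_tree T,
  T.1 = [set v | st v != 0] & forall u v, (u, v) \in T.2 -> st u = 3].

Lemma tree_inv_set st x c :
  leaf_status (st x) -> leaf_status c -> tree_inv st ->
  tree_inv (set_status st x c).
Proof.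
move=> /andP[x0 x3] /andP[c0 c3] [T [tT T1 T2]]; exists T; split=> //.
  rewrite T1; apply/setP=> v; rewrite !inE /set_status.
  by case: (v =P x) => // ->; rewrite x0 c0.
move=> u v /T2 u3; rewrite /set_status; case: eqP => // ux.
by rewrite -ux u3 in x3.
Qed.

Lemma tree_inv_expand st x :
  leaf_status (st x) -> tree_inv st -> tree_inv (expand st x).
Proof.
move=> /andP[x0 x3] [T [tT T1 T2]].
have [||y|T' [tT' T1' T2']] := @out_tree_grow _ T x (enum (fresh st x)) tT.
- by rewrite T1 inE.
- exact: enum_uniq.
- by rewrite mem_enum T1 !inE negbK.
exists T'; split=> //.
  rewrite T1' T1; apply/setP=> v; rewrite !inE mem_enum /expand /set_status.
  case: (v =P x) => [->|_]; first by rewrite x0.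
  have [v0|v0] := boolP (fresh st x v);
    last by rewrite -topredE /= (negPf v0) orbF.
  by rewrite -topredE /= v0 orbT /child_status; case: ifP.
move=> u v /T2'; rewrite /expand /set_status; case: eqP => // _ [//|/T2 u3].
by rewrite /fresh /= u3 andbF.
Qed.

Lemma tree_inv_branch s : tree_inv s.1 -> tree_inv (branch s).1.
Proof.
rewrite /branch => inv; case: pickP => [x /eqP x4|_].
  by apply: tree_inv_expand; rewrite ?x4.
case: pickP => [x /eqP x1|_] //=; apply: tree_inv_set; rewrite ?x1 //.
by case: ifP.
Qed.

Lemma accepts_sound k r g : accepts k r g -> k <= ell D.
Proof.
rewrite /accepts; have: tree_inv (init_status r, g).1.
  exists ([set r], set0); split=> [||u v];
    [exact: out_tree1 | | by rewrite inE].
  by apply/setP=> v; rewrite !inE /= /init_status /set_status; case: (v =P r).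
elim: (_ + #|D|) (init_status r, g) => [|i IH] s inv; last first.
  by rewrite iterSr; apply: IH; apply: tree_inv_branch.
case: inv => T [tT T1 T2] /leq_trans le_k; apply: (leq_ell tT); apply: le_k.
apply: subset_leq_card; apply/subsetP=> v; rewrite !inE T1 inE.
move=> /andP[-> v3] /=; apply/forallP=> u; apply: contra v3.
by move=> /T2 /= ->.
Qed.

End Branching.

(** * Completeness, in terms of sets of inner vertices *)

Section Completeness.
Variables (D : digraph) (r : D) (k : nat).
Implicit Types (st : D -> nat) (x y u v : D) (J S : {set D}).

(** The vertex set of the tree rooted at [r] in which the vertices of [J] have been expanded. *)
Definition reached J v := (v == r) || [exists u, (u \in J) && arc u v].

(* Every vertex of [J] is reachable from [r] inside [J]; the empty set is
   allowed. *)
Definition conn J :=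
  [forall S : {set D}, [&& (r \in J) ==> (r \in S)
    & [forall u in J, forall v in J, (u \in S) && arc u v ==> (v \in S)]]
    ==> (J \subset S)].

Lemma connP J :
  reflect (forall S : {set D}, (r \in J -> r \in S) ->
    (forall u v, u \in J -> v \in J -> u \in S -> arc u v -> v \in S) ->
    J \subset S) (conn J).
Proof.
apply: (iffP forallP) => [cJ S rS arcS|cJ S].
  have /implyP := cJ S; apply; apply/andP; split; first exact/implyP.
  apply/forall_inP=> u uJ; apply/forall_inP=> v vJ; apply/implyP.
  by case/andP; apply: arcS.
apply/implyP=> /andP[/implyP rS /forall_inP arcS];
  apply: cJ => // u v uJ vJ uS uv.
by have /forall_inP/(_ v vJ)/implyP := arcS u uJ; apply; rewrite uS.
Qed.

Definition boundary J := [set v | (v \notin J) && reached J v].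

Definition inner st := [set v | st v == 3].

(** In contrast to [tree_inv], this records that every out-neighbour of an inner vertex lies in the
    tree. *)
Definition grown st :=
  conn (inner st) /\ forall v, st v <= 4 /\ (st v != 0) = reached (inner st) v.

(** A solution, given by its inner vertices, that respects the decisions made so far; statuses 0 and
    1 leave it free. *)
Definition witness st J :=
  [&& conn J, [forall v, (2 < st v) ==> (v \in J)],
      [forall v, (st v == 2) ==> (v \notin J)] & k <= #|boundary J|].

Lemma witnessP st J :
  reflect [/\ conn J, forall v, 2 < st v -> v \in J,
    forall v, st v = 2 -> v \notin J & k <= #|boundary J|] (witness st J).
Proof.
apply: (iffP and4P) => -[cJ iJ oJ kJ]; split=> //.
- by move=> v; apply/implyP/(forallP iJ).
- by move=> v /eqP; apply/implyP/(forallP oJ).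
- by apply/forallP=> v; apply/implyP/iJ.
- by apply/forallP=> v; apply/implyP=> /eqP/oJ.
Qed.

Lemma reached_sub J J' v : J \subset J' -> reached J v -> reached J' v.
Proof.
move=> sJ /orP[rv|/existsP[u /andP[/(subsetP sJ) uJ uv]]]; apply/orP;
  [by left|].
by right; apply/existsP; exists u; rewrite uJ.
Qed.

Lemma inner_set st x c :
  leaf_status (st x) -> leaf_status c -> inner (set_status st x c) = inner st.
Proof.
move=> /andP[_ x3] /andP[_ c3]; apply/setP=> v; rewrite !inE /set_status.
by case: (v =P x) => // ->; rewrite (negPf x3) (negPf c3).
Qed.

Lemma inner_expand st x : inner (expand st x) = x |: inner st.
Proof.
apply/setP=> v; rewrite !inE /expand /set_status; case: (v =P x) => //= _.
case: ifP => //= /andP[_ /eqP->]; rewrite /child_status; by case: ifP.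
Qed.

Lemma grown_set st x c : leaf_status (st x) -> leaf_status c -> c <= 4 ->
  grown st -> grown (set_status st x c).
Proof.
move=> lx lc c4 [cI gI]; split=> [|v]; rewrite inner_set //.
rewrite /set_status; case: (v =P x) => [->|_]; last exact: gI.
by have [_ <-] := gI x; case/andP: lx => ->; case/andP: lc => ->.
Qed.

Lemma grown_expand st x : leaf_status (st x) -> grown st -> grown (expand st x).
Proof.
move=> /andP[x0 _] [cI gI]; split=> [|v]; rewrite inner_expand.
  apply/connP=> S rS arcS; have IS : inner st \subset S.
    move/connP: cI; apply=> [rI|u v uI vI]; first by rewrite rS // inE rI orbT.
    by apply: arcS; rewrite inE ?uI ?vI orbT.
  rewrite subUset IS andbT sub1set; have [_] := gI x; rewrite x0 => /esym/orP[].
    by move=> /eqP xr; rewrite xr rS // xr setU11.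
  move=> /existsP[u /andP[uI ux]]; apply: (arcS u) ux; rewrite ?setU11 //.
    by rewrite inE uI orbT.
  exact: (subsetP IS).
have [v4 gv] := gI v.
have -> : reached (x |: inner st) v = (st v != 0) || arc x v.
  rewrite gv /reached -orbA; congr (_ || _); apply/existsP/orP.
    move=> [u]; rewrite inE => /andP[/orP[/set1P-> ->|uI uv]]; first by right.
    by left; apply/existsP; exists u; rewrite uI.
  case=> [/existsP[u /andP[uI uv]]|xv]; first by exists u; rewrite inE uI orbT.
  by exists x; rewrite setU11.
rewrite /expand /set_status; case: (v =P x) => [->|_]; first by rewrite x0.
rewrite /fresh /= /child_status; case: eqP => [->|v0];
  last by rewrite andbF /=; case: (st v) v0 v4.
by case: (arc x v) => //=; case: ifP.
Qed.

(* Exchange argument behind the algorithm: making [x] a leaf loses at most the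
   vertices of [fresh st x] and gains [x]. *)
Lemma witness_shrink st x J :
    grown st -> st x = 4 -> witness st J -> #|fresh st x| <= 1 ->
    {in J, forall y, ~~ fresh st x y} ->
  witness (set_status st x 2) (J :\ x).
Proof.
move=> [cI gI] x4 /witnessP[cJ iJ oJ kJ] f1 fJ.
have xJ : x \in J by rewrite iJ ?x4.
have IJ : inner st \subset J :\ x.
  apply/subsetP=> v; rewrite !inE => /eqP v3; rewrite iJ ?v3 // andbT.
  by apply: contra_eqN v3 => /eqP->; rewrite x4.
have seen v : st v != 0 -> reached (J :\ x) v.
  by have [_ ->] := gI v; apply: reached_sub.
apply/witnessP; split=> [|v|v|].
- apply/connP=> S rS arcS; rewrite subDset.
  have IS : inner st \subset S.
    move/connP: cI; apply=> [rI|u v uI vI]; first exact/rS/(subsetP IJ).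
    by apply: arcS; apply: (subsetP IJ).
  move/connP: cJ; apply=> [rJ|u v uJ vJ uS uv]; rewrite !inE.
    by case: eqP => //= /eqP rx; rewrite rS // !inE rx.
  have [//|vx /=] := eqVneq v x.
  have vJx : v \in J :\ x by rewrite !inE vx.
  have [ux|ux] := eqVneq u x; last first.
    apply: (arcS u) uv => //; first by rewrite !inE ux.
    by move: uS; rewrite !inE (negPf ux).
  (* Here [v] loses its predecessor [x]. Being in [J], it is not fresh, so it was in the tree
     before: it is the root or has a predecessor in [inner st], which avoids [x]. *)
  have v0 : st v != 0 by have := fJ v vJ; rewrite /fresh /= -ux uv.
  have [_] := gI v; rewrite v0 => /esym/orP[/eqP vr|];
    first by rewrite vr rS -?vr.
  case/existsP=> w /andP[wI wv]; apply: (arcS w) wv => //.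
    exact: (subsetP IJ).
  exact: (subsetP IS).
- rewrite /set_status !inE; case: eqP => //= _; exact: iJ.
- rewrite /set_status !inE; case: eqP => //= _; exact: oJ.
apply: leq_trans kJ _.
have sub : x |: (boundary J :\: [set y | fresh st x y]) \subset boundary (J :\
  x).
  apply/subsetP=> v; rewrite !inE => /predU1P[->|/and3P[fv vJ Jv]].
    by rewrite eqxx /= seen ?x4.
  rewrite (negPf vJ) andbF /=; case/orP: Jv => [rv|/existsP[u /andP[uJ uv]]].
    by rewrite /reached rv.
  have [ux|ux] := eqVneq u x.
    by apply: seen; move: fv; rewrite /fresh /= -ux uv.
  by apply/orP; right; apply/existsP; exists u; rewrite !inE ux uJ.
apply: leq_trans (subset_leq_card sub); rewrite cardsU1 !inE xJ andbF /=.
have F1 : #|[set y | fresh st x y]| <= 1 by rewrite cardsE.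
have := subset_leq_card (subsetIr (boundary J) [set y | fresh st x y]).
by rewrite cardsD; lia.
Qed.

Lemma eq_witness st st' J : st =1 st' -> witness st J = witness st' J.
Proof.
by move=> eq_st; apply/witnessP/witnessP=> -[cJ iJ oJ kJ]; split=> // v;
  [rewrite -eq_st; apply: iJ | rewrite -eq_st; apply: oJ
  |rewrite eq_st; apply: iJ | rewrite eq_st; apply: oJ].
Qed.

Lemma witness_red st x J : x \notin J -> witness st J ->
  witness (set_status st x 2) J.
Proof.
move=> xJ /witnessP[cJ iJ oJ kJ]; apply/witnessP; split=> // v;
  by rewrite /set_status; case: eqP => [->|_] //; first [exact: iJ | exact: oJ].
Qed.

(** With nothing left to decide, a vertex of [J] that is in the tree is inner. Connectedness then
    puts all of [J] inside [inner st], so the boundary of [J] lies in the tree, and none of it is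
    inner. *)
Lemma witness_stuck st J : grown st -> (forall v, st v != 1) ->
  (forall v, st v != 4) -> witness st J -> k <= nleaves st.
Proof.
move=> [_ gI] no1 no4 /witnessP[/connP cJ iJ oJ kJ].
have inn v : v \in J -> st v != 0 -> st v == 3.
  move=> vJ v0; have [] := gI v; move: v0 (no1 v) (no4 v) (oJ v); rewrite vJ.
  by case: (st v) => [|[|[|[|[|]]]]] // _ _ _ /(_ erefl).
have JI : J \subset inner st.
  apply: cJ => [rJ|u v uJ vJ uI uv]; rewrite inE inn //.
    by have [_ ->] := gI r; rewrite /reached eqxx.
  have [_ ->] := gI v; apply/orP; right; apply/existsP; exists u.
  by rewrite uI.
apply: leq_trans kJ _; apply: subset_leq_card; apply/subsetP=> v.
rewrite !inE => /andP[vJ /(reached_sub JI)]; have [_ <-] := gI v.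
rewrite /leaf_status => -> /=; apply: contra vJ => /eqP v3.
by rewrite iJ ?v3.
Qed.

Definition nred st := #|[pred v | st v == 2]|.
(** Bounds the number of expansions still to come. *)
Definition nouter st := #|[pred v | st v != 3]|.

Lemma nred_le st : nred st <= nleaves st.
Proof. by apply: subset_leq_card; apply/subsetP=> v;
  rewrite !inE => /eqP->. Qed.

Lemma nleaves_set st x c : leaf_status (st x) -> leaf_status c ->
  nleaves (set_status st x c) = nleaves st.
Proof.
move=> lx lc; apply: eq_card => v; rewrite !inE /set_status.
by case: (v =P x) => // ->; rewrite lx lc.
Qed.

Lemma nouter_set st x c : st x != 3 -> c != 3 ->
  nouter (set_status st x c) = nouter st.
Proof.
move=> lx lc; apply: eq_card => v; rewrite !inE /set_status.
by case: (v =P x) => // ->; rewrite lx lc.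
Qed.

Lemma nred_set st x c : st x != 2 ->
  nred (set_status st x c) = (c == 2) + nred st.
Proof.
move=> x2; rewrite /nred (cardD1 x) !inE /set_status eqxx; congr (_ + _).
apply: eq_card => v; rewrite !inE; case: (v =P x) => //= ->.
by rewrite (negPf x2).
Qed.

Lemma nouter_expand st x : st x != 3 ->
  nouter st = (nouter (expand st x)).+1.
Proof.
move=> x3; rewrite /nouter (cardD1 x) !inE x3; congr _.+1.
apply: eq_card => v; rewrite !inE /expand /set_status; case: (v =P x) => //= _.
by case: ifP => // /andP[_ /eqP->]; rewrite /child_status; case: ifP.
Qed.

Lemma nred_expand st x : st x != 2 -> nred (expand st x) = nred st.
Proof.
move=> x2; apply: eq_card => v; rewrite !inE /expand /set_status.
case: (v =P x) => [->|_]; first by rewrite (negPf x2).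
by case: ifP => // /andP[_ /eqP->]; rewrite /child_status; case: ifP.
Qed.

Lemma nleaves_expand st x : leaf_status (st x) ->
  (nleaves (expand st x)).+1 = nleaves st + #|fresh st x|.
Proof.
move=> lx; have /andP[x0 _] := lx.
rewrite addnC /nleaves (cardD1 x [pred v | leaf_status (st v)]) !inE lx addnS;
  congr _.+1.
rewrite -cardUI [X in _ = _ + X]eq_card0 ?addn0 => [|v]; last first.
  rewrite !inE; apply/negbTE/negP=> /andP[/andP[_ /eqP v0]].
  by rewrite v0 andbF.
apply: eq_card => v; rewrite !inE /expand /set_status.
case: (v =P x) => [->|_] /=; first by rewrite (negPf x0) andbF.
rewrite /fresh /=; case: (arc x v) => //=; case: (st v =P 0) => //= _.
by rewrite /child_status; case: ifP.
Qed.

(** Zero bits only settle undecided leaves. So once [k] leaves are present and no expansion is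
    pending, the remaining steps cannot lose any. *)
Lemma nleaves_guess0 st i : (forall v, st v != 4) ->
  nleaves (iter i (@branch D) (st, 0)).1 = nleaves st.
Proof.
elim: i st => // i IH st no4; rewrite iterSr /branch /=.
case: pickP => [x|_]; first by rewrite (negPf (no4 x)).
case: pickP => [x /eqP x1|_] /=; last exact: IH.
rewrite IH ?nleaves_set ?x1 // => v.
by rewrite /set_status; case: ifP.
Qed.

Definition good_guess st b i :=
  exists2 g, g < 2 ^ b & k <= nleaves (iter i (@branch D) (st, g)).1.

(* The potential [nleaves + nred] is at most [2k - 2] while fewer than [k]
   leaves are present, and every bit of the guess increases it. *)
Lemma good_guess_exists i st b : grown st -> b + nouter st <= i ->
  ((forall v, st v != 4) -> (exists J, witness st J) ->
    k + k <= b + (nleaves st + nred st) -> good_guess st b i) /\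
  (forall x, (forall v, (st v == 4) = (v == x)) -> (exists J, witness st J) ->
    (forall J, ~~ witness (set_status st x 2) J) ->
    k + k <= (b + (nleaves st + nred st)).+1 -> good_guess st b i).
Proof.
(* The second part treats a pending expansion of [x] chosen because no witness keeps [x] as a leaf.
   A bit 1 has then been spent without gain, hence the slack of one. Two or more fresh vertices
   repay it; a single one passes the pending state on to it; none at all is impossible by the
   exchange argument. *)
elim: i st b => [|i IH] st b gst le_i; split.
(* No bits are left, so [2 k <= nleaves + nred <= 2 nleaves]. *)
- move=> no4 _ le_k; exists 0; rewrite ?expn_gt0 //=; have := nred_le st; lia.
- move=> x x4 _ _ _; move: le_i; rewrite leqn0 addn_eq0 => /andP[_ /eqP].
  move/card0_eq/(_ x); rewrite !inE; have := x4 x; rewrite eqxx => /eqP->.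
  by [].
- move=> no4 [J wJ] le_k; have [le_kn|lt_nk] := leqP k (nleaves st).
    by exists 0; rewrite ?expn_gt0 // nleaves_guess0.
  have := nred_le st; case: b le_i le_k => [|b] le_i le_k le_r; first lia.
  have no4' : [pick x | st x == 4] = None.
    by case: pickP => // x; rewrite (negPf (no4 x)).
  case E1: [pick x | st x == 1] => [x|]; last first.
    have no1 v : st v != 1 by case: pickP E1 => // /(_ v)->.
    by have := witness_stuck gst no1 no4 wJ; rewrite leqNgt lt_nk.
  have x1 : st x = 1 by case: pickP E1 => // y /eqP y1 [<-].
  have {}E1 g : branch (st, g) = (set_status st x (if odd g then 4 else 2),
    g./2).
    by rewrite /branch /= no4' E1.
  have le_i' c : c != 3 -> b + nouter (set_status st x c) <= i.
    by move=> c3; rewrite nouter_set ?x1 //; lia.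
  (* Bit 0 is preferred whenever some witness allows it. Bit 1 is thus used only with the knowledge
     [noJ], on which the forced expansions rest. *)
  case: (pickP (witness (set_status st x 2))) => [J2 wJ2|noJ].
    have [|IH2 _] := IH (set_status st x 2) b _ (le_i' 2 isT).
      by apply: grown_set; rewrite ?x1.
    have [v|||g lt_g kg] := IH2.
    + by rewrite /set_status; case: ifP => // _; apply: no4.
    + by exists J2.
    + by rewrite nleaves_set ?nred_set ?x1 //=; lia.
    exists g.*2; first by rewrite expnS; lia.
    by rewrite iterSr E1 odd_double doubleK.
  have [|_ IH2] := IH (set_status st x 4) b _ (le_i' 4 isT).
    by apply: grown_set; rewrite ?x1.
  have [v||J'||g lt_g kg] := IH2 x.
  + by rewrite /set_status; case: (v =P x) => // _; apply: negbTE.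
  + have xJ : x \in J.
      by apply: contraFT (noJ J) => xJ; apply: witness_red.
    have /witnessP[cJ iJ oJ kJ] := wJ; exists J; apply/witnessP; split=> // v;
    by rewrite /set_status; case: eqP => [->|_] //;
      first [exact: iJ | exact: oJ].
  + rewrite (@eq_witness _ (set_status st x 2)) ?noJ // => v.
    by rewrite /set_status; case: eqP.
  + by rewrite nleaves_set ?nred_set ?x1 //=; lia.
  exists g.*2.+1; first by rewrite expnS; lia.
  by rewrite iterSr E1 /= odd_double uphalf_double.
- move=> x Ex [J wJ] noJ le_k; have x4 : st x = 4 by apply/eqP; rewrite Ex.
  have brE g : branch (st, g) = (expand st x, g).
    rewrite /branch /=; case: pickP => [y|/(_ x)]; last by rewrite x4.
    by rewrite Ex => /eqP->.
  have lx : leaf_status (st x) by rewrite x4.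
  have ge : grown (expand st x) by apply: grown_expand.
  have le_i' : b + nouter (expand st x) <= i.
    by have := @nouter_expand st x; rewrite x4 => /(_ isT); lia.
  have nle := nleaves_expand lx; have nre : nred (expand st x) = nred st.
    by rewrite nred_expand ?x4.
  (* Otherwise [witness_shrink] would give a witness with [x] as a leaf, against [noJ]. *)
  have shrink J' : witness st J' -> #|fresh st x| <= 1 ->
      exists2 y, fresh st x y & y \in J'.
    move=> w' f1; case: (pickP [pred y | fresh st x y & y \in J']) => [y|no].
      by case/andP; exists y.
    have /negP[] := noJ (J' :\ x); apply: witness_shrink => // y yJ.
    by have := no y; rewrite /= yJ andbT => ->.
  have we : #|fresh st x| <= 1 \/ child_status #|fresh st x| = 1 ->
      witness (expand st x) J.
    move=> f1; have /witnessP[cJ iJ oJ kJ] := wJ; apply/witnessP; split=> // v.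
      rewrite /expand /set_status; case: eqP => [->|_]; first by rewrite iJ ?x4.
      case: ifP => [fv|_]; last exact: iJ.
      case: f1 => [f1|->] // _.
      have [y fy yJ] := shrink J wJ f1; suff -> : v = y by [].
      by have /card_le1_eqP := f1; apply.
    rewrite /expand /set_status; case: eqP => // _; case: ifP => // _.
      by rewrite /child_status; case: ifP.
    exact: oJ.
  have [f1|f2] := leqP #|fresh st x| 1.
    have [y fy yJ] := shrink J wJ f1.
    have fE v : fresh st x v = (v == y).
      apply/idP/eqP => [fv|->//]; by have /card_le1_eqP := f1; apply.
    have f11 : #|fresh st x| = 1.
      by apply/eqP; rewrite eqn_leq f1; apply/card_gt0P; exists y.
    have xy : x != y.
      by apply: contraTneq fy => <-; rewrite /fresh /= x4 andbF.
    have [_ IH2] := IH _ b ge le_i'.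
    have [v||J'||g lt_g kg] := IH2 y; first last.
    + by exists g => //; rewrite iterSr brE.
    + by lia.
    (* The knowledge passes from [x] to [y]: a witness with [y] as a leaf would also be one before
       the expansion, and [shrink] would force it to contain the only fresh vertex, [y]. *)
    + apply/negP=> w'.
      have /witnessP[cJ' iJ' oJ' kJ'] := w'.
      have stE v : st v != 0 -> v != x ->
          set_status (expand st x) y 2 v = st v.
        rewrite /expand /set_status fE;
          case: (v =P y) => [-> /negP[]|_ _ /negPf->] //.
        by case/andP: fy.
      have w2 : witness st J'.
        apply/witnessP; split=> // v v2.
          apply: iJ'; have [->|vx] := eqVneq v x.
            by rewrite /expand /set_status (negPf xy) eqxx.
          by rewrite stE //; case: (st v) v2.
        apply: oJ'; rewrite stE ?v2 //.
        by apply: contra_eqN v2 => /eqP->; rewrite x4.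
      have [z fz zJ] := shrink J' w2 f1.
      move: fz zJ; rewrite fE => /eqP->; apply/negP.
      by apply: oJ'; rewrite /set_status eqxx.
    + by exists J; apply: we; left.
    + rewrite /expand /set_status fE f11 /child_status.
      have [->|vx] := eqVneq v x; first by rewrite (negPf xy).
      by case: ifP => // _; rewrite Ex (negPf vx).
  have c1 : child_status #|fresh st x| = 1.
    by rewrite /child_status; case: eqP => // f1; rewrite f1 in f2.
  have [IH2 _] := IH _ b ge le_i'.
  have [v|||g lt_g kg] := IH2.
  + rewrite /expand /set_status; have [//|vx] := eqVneq v x.
    by rewrite c1; case: ifP => // _; rewrite Ex (negPf vx).
  + by exists J; apply: we; right.
  + by lia.
  by exists g => //; rewrite iterSr brE.
Qed.

End Completeness.

Lemma accepts_complete (D : digraph) k : 0 < k -> k <= ell D ->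
  exists (r : D) g, g < 2 ^ (k + k) /\ accepts k r g.
Proof.
move=> k_gt0 /(ell_geP k_gt0)[T tT kT];
  have [r [rT par Tind]] := out_tree_root tT.
have /and3P[subT _ _] := tT.
have T2 u v : (u, v) \in T.2 -> [/\ u \in T.1, v \in T.1 & arc u v].
  by move: subT => /forallP/(_ u)/forallP/(_ v)/implyP h /h /and3P[].
(* Every leaf of [T] is in the boundary of [J], through its parent or, if [T] is a single vertex, as
   the root. The boundary may be larger, since [T] need not use all out-neighbours of [J]. *)
pose J := T.1 :\: leaves T.
have parJ u v : (u, v) \in T.2 -> u \in J.
  move=> uv; have [uT _ _] := T2 _ _ uv; rewrite !inE uT /= andbT.
  by rewrite negb_forall; apply/existsP; exists v; rewrite negbK.
have i0 : inner (init_status r) = set0.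
  by apply/setP=> v; rewrite !inE /init_status /set_status; case: (v =P r).
have [||gg _] := @good_guess_exists D r k (k + k + #|D|) (init_status r) (k +
  k).
- split=> [|v]; rewrite i0.
    by apply/connP=> S _ _; rewrite sub0set.
  rewrite /reached /init_status /set_status; case: (v =P r) => //= _;
    split=> //.
  by apply/esym/negbTE/existsPn=> u; rewrite inE.
- by rewrite leq_add2l max_card.
have [v|||g lt_g acc] := gg; last by exists r, g.
- by rewrite /init_status /set_status; case: ifP.
- exists J; apply/witnessP; split=> [|v|v|].
  + apply/connP=> S rS arcS; rewrite subDset; apply: Tind => [|u v].
      rewrite inE; case: (boolP (r \in leaves T)) => //= rl.
      by apply: rS; rewrite inE rl.
    move=> + uv; have [uT vT a_uv] := T2 _ _ uv; have uJ := parJ _ _ uv.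
    have := uJ; rewrite inE => /andP[/negPf ul _].
    rewrite inE ul /= => uS; rewrite inE.
    case: (boolP (v \in leaves T)) => //= vl.
    by apply: (arcS u) a_uv; rewrite // inE vl.
  + by rewrite /init_status /set_status; case: ifP.
  + by rewrite /init_status /set_status; case: ifP.
  apply: leq_trans kT _; apply: subset_leq_card; apply/subsetP=> v vl.
  rewrite inE inE vl /=; have vT : v \in T.1 by move: vl;
    rewrite inE => /andP[].
  apply/orP; have [//|vr] := eqVneq v r; first by left.
  right; have [u uv] := par v vT vr; apply/existsP; exists u.
  by rewrite (parJ _ _ uv); have [] := T2 _ _ uv.
- exact: leq_addr.
Qed.

(** * Structured programs with time bounds *)

(** [Cond] takes its first branch when the register is nonzero, and [Loop] repeats as long as it is
    nonzero. *)
Inductive cmd :=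
  | Block of seq instr
  | Seq of cmd & cmd
  | Cond of nat & cmd & cmd
  | Loop of nat & cmd.

Notation "c1 ;; c2" := (Seq c1 c2) (at level 60, right associativity).

Fixpoint csize c :=
  match c with
  | Block l => size l
  | c1 ;; c2 => csize c1 + csize c2
  | Cond _ c1 c2 => csize c1 + csize c2 + 2
  | Loop _ c1 => csize c1 + 2
  end.

(** Jump targets are absolute, so the code depends on the address [a] where it will stand. *)
Fixpoint compile a c : program :=
  match c with
  | Block l => l
  | c1 ;; c2 => compile a c1 ++ compile (a + csize c1) c2
  | Cond r c1 c2 =>
      let b := a + csize c1 + 2 in
      IJumpZ r b :: compile a.+1 c1 ++ IJump (b + csize c2) :: compile b c2
  | Loop r c1 =>
      IJumpZ r (a + csize c1 + 2) :: compile a.+1 c1 ++ [:: IJump a]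
  end.

Lemma size_compile c a : size (compile a c) = csize c.
Proof.
elim: c a => [l|c1 IH1 c2 IH2|r c1 IH1 c2 IH2|r c IH] a //=;
  rewrite size_cat /= ?IH1 ?IH2 ?IH; lia.
Qed.

Definition straight (i : instr) :=
  match i with IJump _ | IJumpZ _ _ | IHalt => false | _ => true end.

Definition exec1 (m : memory) (i : instr) : memory :=
  match i with
  | IConst r c => upd m r c
  | IMove r j => upd m r (m j)
  | IAdd r j l => upd m r (m j + m l)
  | ISub r j l => upd m r (m j - m l)
  | IHalf r j => upd m r (m j)./2
  | ILoad r j => upd m r (m (m j))
  | IStore r j => upd m (m r) (m j)
  | _ => m
  end.

Definition exec (m : memory) (l : seq instr) : memory := foldl exec1 m l.

Definition placed (P : program) a (l : seq instr) :=
  forall j, j < size l -> nth IHalt P (a + j) = nth IHalt l j.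

Lemma placed_cons P a i l :
  placed P a (i :: l) -> nth IHalt P a = i /\ placed P a.+1 l.
Proof.
move=> Pl; split=> [|j lt_j]; first by have := Pl 0 isT; rewrite addn0.
by rewrite addSnnS (Pl j.+1).
Qed.

Lemma placed_cat P a l1 l2 :
  placed P a (l1 ++ l2) -> placed P a l1 /\ placed P (a + size l1) l2.
Proof.
move=> Pl; split=> j lt_j.
  by rewrite Pl ?nth_cat ?lt_j // size_cat ltn_addr.
rewrite -addnA Pl ?size_cat ?ltn_add2l // nth_cat ltnNge leq_addr /=.
by rewrite addKn.
Qed.

Lemma placed_all P : placed P 0 P.
Proof. by []. Qed.

(* Total correctness with a time bound: started on [m], wherever its code is
   placed, [c] runs off its end after at most [T] steps, in a memory
   satisfying [Q]. *)
Definition runs c m T (Q : memory -> Prop) :=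
  exists t m', [/\ t <= T, Q m' & forall P a, placed P a (compile a c) ->
    iter t (step P) (a, m) = (a + csize c, m')].

Lemma runs_post c m T (Q Q' : memory -> Prop) :
  runs c m T Q -> (forall m', Q m' -> Q' m') -> runs c m T Q'.
Proof. by move=> [t [m' [? Qm' ?]]] QQ'; exists t, m'; split; auto. Qed.

Lemma runs_le c m T T' Q : runs c m T Q -> T <= T' -> runs c m T' Q.
Proof.
by move=> [t [m' [le_t ? ?]]] leT; exists t, m'; split=> //;
  apply: leq_trans leT.
Qed.

Lemma runs_block l m Q :
  all straight l -> Q (exec m l) -> runs (Block l) m (size l) Q.
Proof.
move=> sl Qm; exists (size l), (exec m l); split=> // P a /= {Qm}.
elim: l m a sl => [|i l IH] m a /=; first by rewrite addn0.
case/andP=> si sl /placed_cons [Pi /(IH (exec1 m i) _ sl) {}IH].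
rewrite -iterS iterSr /= /fetch /= Pi addnS -addSn.
by case: i si {Pi} IH.
Qed.

Lemma runs_seq c1 c2 m T1 T2 Q :
  runs c1 m T1 (fun m' => runs c2 m' T2 Q) -> runs (c1 ;; c2) m (T1 + T2) Q.
Proof.
move=> [t1 [m1 [le1 [t2 [m2 [le2 Qm2 E2]]] E1]]].
exists (t2 + t1), m2; split=> // [|P a /= /placed_cat[/E1 {}E1]].
  by rewrite addnC leq_add.
by rewrite size_compile => /E2 {}E2; rewrite iterD E1 E2 addnA.
Qed.

(** The sum stands in for the maximum, so that each branch is bounded on its own; the extra 2 pays
    for the test and the jump over the second branch. *)
Lemma runs_cond r c1 c2 m T1 T2 Q :
  (0 < m r -> runs c1 m T1 Q) -> (m r = 0 -> runs c2 m T2 Q) ->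
  runs (Cond r c1 c2) m (T1 + T2).+2 Q.
Proof.
move=> R1 R2; case: (posnP (m r)) => [r0|r_gt0].
  have [t [m' [le_t Qm' E]]] := R2 r0.
  exists t.+1, m'; split=> // [|P a /= /placed_cons[Pa]]; first lia.
  move=> /placed_cat[_]; rewrite size_compile => /placed_cons[_].
  have -> : (a.+1 + csize c1).+1 = a + csize c1 + 2 by lia.
  move=> /E {}E; rewrite -iterS iterSr /= /fetch /= Pa r0 eqxx E.
  congr pair; lia.
have [t [m' [le_t Qm' E]]] := R1 r_gt0.
exists t.+2, m'; split=> // [|P a /= /placed_cons[Pa]]; first lia.
move=> /placed_cat[/E {}E]; rewrite size_compile => /placed_cons[Pj _].
rewrite -(iterS t) (iterSr t) /= /fetch /= Pa eqn0Ngt r_gt0 /= E /=.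
rewrite /fetch /= Pj; congr pair; lia.
Qed.

(** The invariant is indexed by the counter, which counts down to 0. A round costs a test and a jump
    back besides [T]; the final test adds one. *)
Lemma runs_loop r c T (A : nat -> memory -> Prop) n m :
    (forall i m, A i m -> m r = i) ->
    (forall i m, i < n -> A i.+1 m -> runs c m T (A i)) ->
  A n m -> runs (Loop r c) m (n * T.+2).+1 (A 0).
Proof.
move=> Ar; elim: n m => [|n IH] m Ac Am.
  exists 1, m; split=> // P a /= /placed_cons[Pa _].
  by rewrite /= /fetch /= Pa (Ar _ _ Am) eqxx addnA.
have [t1 [m1 [le1 Am1 E1]]] := Ac n m (ltnSn n) Am.
have [i m' lt_i|t2 [m2 [le2 Am2 E2]]] := IH m1 _ Am1; first by apply: Ac; lia.
exists (t2 + t1.+2), m2; split=> // [|P a Pl]; first lia.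
rewrite iterD; move: (Pl); case/placed_cons=> Pa.
move=> /placed_cat[/E1 {}E1]; rewrite size_compile => /placed_cons[Pj _].
rewrite (iterS t1.+1) (iterSr t1) /= /fetch /= Pa (Ar _ _ Am) /= E1 /=.
by rewrite /fetch /= Pj E2.
Qed.

(** Past its end the program fetches the default [IHalt], and halted configurations are fixed by
    [step], so a run that ends early is still in place at time [T]. *)
Lemma runs_outputs c w T v :
  runs c (nth 0 w) T (fun m => m 0 = v) ->
  outputs_within (compile 0 c) w T v.
Proof.
move=> [t [m [le_t mv E]]]; rewrite /outputs_within -(subnK le_t) iterD.
rewrite /init (E _ _ (@placed_all _)) add0n.
set P := compile 0 c; set s := (csize c, m).
have hs : fetch P s = IHalt by rewrite /fetch nth_default ?size_compile.
suff -> : iter (T - t) (step P) s = s by rewrite /halted hs.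
by elim: (T - t) => //= i ->; rewrite /step /= hs.
Qed.

(** As [b] is a constant, the [b] doublings of a round are unrolled, and counting down [k] is the
    only loop. *)
Lemma computable_exp a b : computable (fun k => a * 2 ^ (b * k)).
Proof.
pose c := Block [:: IConst 1 a; IConst 2 1] ;;
  Loop 0 (Block (ISub 0 0 2 :: nseq b (IAdd 1 1 1))) ;;
  Block [:: IMove 0 1].
exists (compile 0 c) => k.
have dbl j (m : memory) : let m' := exec m (nseq j (IAdd 1 1 1)) in
    [/\ m' 0 = m 0, m' 1 = m 1 * 2 ^ j & m' 2 = m 2].
  elim: j m => [|j IH] m /=; first by rewrite muln1.
  have [-> -> ->] := IH (upd m 1 (m 1 + m 1)).
  by split=> //; rewrite /upd /= expnS; lia.
pose A i (m : memory) :=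
  [/\ m 0 = i, m 1 = a * 2 ^ (b * (k - i)) & m 2 = 1].
have R : runs c (nth 0 [:: k]) (2 + ((k * (b.+1).+2).+1 + 1))
    (fun m => m 0 = a * 2 ^ (b * k)).
  apply: runs_seq; apply: runs_block => //.
  apply: runs_seq; apply: runs_post.
    apply: (@runs_loop _ _ _ A) => [i m []|i m lt_ik [m0 m1 m2]|] //.
      apply: runs_le (runs_block _ _) _.
      - by rewrite /= all_nseq orbT.
      - have [e0 e1 e2] := dbl b (upd m 0 (m 0 - m 2)).
        rewrite /A /= e0 e1 e2 /upd /= m0 m1 m2; split=> //; first lia.
        rewrite -mulnA -expnD; congr (_ * 2 ^ _).
        by rewrite subnS addnC -mulnS prednK // subn_gt0.
      - by rewrite /= size_nseq.
    by split=> //; rewrite /upd /= subnn muln0 muln1.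
  move=> m [_ m1 _]; apply: runs_block => //=.
  by rewrite /upd /= m1 subn0.
by exists (2 + ((k * (b.+1).+2).+1 + 1)); apply: runs_outputs.
Qed.

(** * Implementation *)

Definition agree (s : seq nat) (m m' : memory) :=
  forall j, j \notin s -> m' j = m j.

Lemma agree_refl s m : agree s m m.
Proof. by []. Qed.

Lemma agree_upd s m m' i v : i \in s -> agree s m m' -> agree s m (upd m' i v).
Proof.
move=> i_s mm' j j_s; rewrite /upd; case: eqP => [ji|_]; last exact: mm'.
by rewrite -ji (negPf j_s) in i_s.
Qed.

Lemma agree_trans s m1 m2 m3 : agree s m1 m2 -> agree s m2 m3 -> agree s m1 m3.
Proof. by move=> h12 h23 j js; rewrite h23 ?h12. Qed.

Lemma agree_sub s s' m m' : {subset s <= s'} -> agree s m m' -> agree s' m m'.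
Proof. by move=> ss mm' j js; apply: mm'; apply: contra js; apply: ss. Qed.

Ltac agree_exec := rewrite /exec /=; do ?[apply: agree_upd => //];
  exact: agree_refl.

(* Registers 0 to 15 are the variables of the program; the entry of index [j]
   of the adjacency matrix is kept in register [2 j + 16] and the status of
   the vertex of index [j] in register [2 j + 17]. *)
Notation "j .+16" := j.+4.+4.+4.+4
  (at level 1, left associativity, format "j .+16") : nat_scope.
Notation "j .+17" := j.+4.+4.+4.+4.+1
  (at level 1, left associativity, format "j .+17") : nat_scope.
Notation rK := 0 (only parsing).
Notation rN := 1 (only parsing).
Notation rOne := 2 (only parsing).
Notation rRes := 3 (only parsing).
Notation rI := 4 (only parsing).
Notation rP := 5 (only parsing).
Notation rQ := 6 (only parsing).
Notation rX := 7 (only parsing).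
Notation rC := 8 (only parsing).
Notation rRow := 9 (only parsing).
Notation rStep := 10 (only parsing).
Notation rBits := 11 (only parsing).
Notation rGuess := 12 (only parsing).
Notation rRoot := 13 (only parsing).
Notation rNGuess := 14 (only parsing).
Notation rNStep := 15 (only parsing).

Definition skip := Block [::].

Definition scan c :=
  Block [:: IMove rI rN] ;; Loop rI (Block [:: ISub rI rI rOne] ;; c).

(** [A i] describes the memory once the indices from [i] on are treated: the scan goes downwards, so
    results refer to [drop i (enum D)]. Stability under writing [rI] is required because the scan
    itself moves the counter. *)
Lemma runs_scan c m n T (A : nat -> memory -> Prop) :
    m rN = n ->
    (forall i m, A i m -> m rOne = 1) ->
    (forall i m v, A i m -> A i (upd m rI v)) ->
    (forall i m, i < n -> A i.+1 m -> m rI = i ->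
       runs c m T (fun m' => m' rI = i /\ A i m')) ->
    A n m ->
  runs (scan c) m (n * T.+3).+2 (A 0).
Proof.
move=> mN A1 AI Ac An; eapply runs_le.
  apply: runs_seq; apply: runs_block => //.
  apply: runs_post.
    apply: (@runs_loop _ _ T.+1 (fun i m => m rI = i /\ A i m) n) => [i m'
      []|i m' lt_i [mi Ai]|] //.
      eapply runs_le.
        apply: runs_seq; apply: runs_block => //.
        apply: Ac => //; first exact: AI.
        by rewrite /= /upd /= mi (A1 _ _ Ai) subn1.
      by [].
    by split; [rewrite /upd /= mN | apply: AI].
  by move=> m' [].
rewrite /=; lia.
Qed.

Definition load_status :=
  Block [:: IAdd rP rI rI; IConst rQ 17; IAdd rP rP rQ; ILoad rQ rP].

Lemma runs_load_status m (Q : memory -> Prop) :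
  (forall m', agree [:: rP; rQ] m m' -> m' rQ = m (m rI).*2.+17 -> Q m') ->
  runs load_status m 4 Q.
Proof.
move=> HQ; apply: runs_block => //; apply: HQ; first by agree_exec.
by rewrite /= /upd /= addnn addnC.
Qed.

Definition store_status x v :=
  Block [:: IAdd rP x x; IConst rQ 17; IAdd rP rP rQ; IStore rP v].

Lemma runs_store_status x v m (Q : memory -> Prop) :
  v \notin [:: rP; rQ] ->
  (forall m', agree [:: rP; rQ; (m x).*2.+17] m m' ->
     m' (m x).*2.+17 = m v -> Q m') ->
  runs (store_status x v) m 4 Q.
Proof.
rewrite !inE negb_or => /andP[/negPf vP /negPf vQ] HQ.
apply: runs_block => //; rewrite /exec /= {3 4}/upd /= addnn addnC.
apply: HQ.
  by do ?[apply: agree_upd; first by rewrite !inE eqxx ?orbT];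
    exact: agree_refl.
by rewrite /upd /= eqxx vP vQ.
Qed.

Definition load_arc :=
  Block [:: IAdd rP rRow rI; IAdd rP rP rP; IConst rQ 16; IAdd rP rP rQ;
            ILoad rQ rP].

Lemma runs_load_arc m (Q : memory -> Prop) :
  (forall m', agree [:: rP; rQ] m m' ->
     m' rQ = m (m rRow + m rI).*2.+16 -> Q m') ->
  runs load_arc m 5 Q.
Proof.
move=> HQ; apply: runs_block => //; apply: HQ; first by agree_exec.
by rewrite /= /upd /= addnn addnC.
Qed.

(** * One branching step on the machine *)

Section Machine.
Variables (D : digraph) (k : nat).
Implicit Types (st : D -> nat) (x y v w : D) (m : memory) (g : nat).
Local Notation n := #|D|.

Definition ix v := index v (enum D).

Lemma ix_inj : injective ix.
Proof. by move=> v w; apply: (index_inj v); rewrite mem_enum. Qed.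

Lemma ix_lt v : ix v < n.
Proof. by rewrite cardE index_mem mem_enum. Qed.

Lemma ixP i : i < n ->
  exists2 v, ix v = i & drop i (enum D) = v :: drop i.+1 (enum D).
Proof.
move=> lt_i; have lt_i' : i < size (enum D) by rewrite -cardE.
pose v0 := enum_val (Ordinal lt_i); exists (nth v0 (enum D) i).
  by rewrite /ix index_uniq // enum_uniq.
exact: drop_nth.
Qed.

Definition env m := [/\ m rK = k, m rN = n, m rOne = 1 &
  forall x y, m (ix x * n + ix y).*2.+16 = arc x y].

Definition has_status m st := forall v, m (ix v).*2.+17 = st v.

(** What a branching step must not touch: the constants and the result, the variables of the outer
    loops except [rBits], and the matrix at even addresses from 16 on. *)
Definition kept j :=
  (j < 4) || (9 < j < 16) && (j != rBits) || (15 < j) && ~~ odd j.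

Lemma kept_mat j : kept j.*2.+16.
Proof. by rewrite /kept /= !negbK odd_double. Qed.

Lemma kept_status j : kept j.*2.+17 = false.
Proof. by rewrite /kept /= !negbK odd_double. Qed.

Definition state m0 m st g :=
  [/\ forall j, kept j -> m j = m0 j, m rBits = g & has_status m st].

Lemma env_kept m m' : env m -> (forall j, kept j -> m' j = m j) -> env m'.
Proof.
case=> mK mN m1 mA mm'; split=> [|||x y]; rewrite mm' //.
exact: kept_mat.
Qed.

Definition temps := [:: rI; rP; rQ; rX; rC; rRow].

Lemma state_agree m0 m m' st g :
  agree temps m m' -> state m0 m st g -> state m0 m' st g.
Proof.
move=> mm' [m0m mB mst]; split=> [j kj||v]; rewrite mm' //; first exact: m0m.
by apply: contraL kj; rewrite !inE => /or4P[||| /or3P[]] /eqP->.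
Qed.

Lemma eq_state m0 m st st' g : st =1 st' -> state m0 m st g -> state m0 m st' g.
Proof. by move=> E [h1 h2 h3]; split=> // v; rewrite h3 E. Qed.

Lemma state_store m0 m m' st g x c :
    agree [:: rP; rQ; (ix x).*2.+17] m m' -> m' (ix x).*2.+17 = c ->
  state m0 m st g -> state m0 m' (set_status st x c) g.
Proof.
move=> mm' mc [m0m mB mst]; split=> [j kj||v]; last first.
- rewrite /set_status; case: eqP => [->//|vx]; rewrite mm' // !inE /=.
  by rewrite -!mul2n !eqSS eqn_mul2l /=; apply/eqP=> /ix_inj.
- by rewrite mm'.
rewrite mm'; first exact: m0m.
apply: contraL kj; rewrite !inE => /or3P[] /eqP-> //.
by rewrite kept_status.
Qed.

(** Equality with [c] is tested by adding both truncated differences. The scan being downward, the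
    last index written is the least one, in agreement with [pick]. *)
Definition find_cmd c :=
  Block [:: IConst rX 0] ;;
  scan (load_status ;;
        Block [:: IConst rC c; ISub rP rQ rC; ISub rQ rC rQ; IAdd rQ rQ rP] ;;
        Cond rQ skip (Block [:: IAdd rX rI rOne])).

Definition opt_ix o := if o is Some v then (ix v).+1 else 0.

Lemma pick_enum (p : pred D) : ohead (filter p (enum D)) = [pick x | p x].
Proof. by rewrite /pick enumT. Qed.

Lemma state_one m0 m st g : env m0 -> state m0 m st g -> m rOne = 1.
Proof. by move=> [_ _ ? _] [mm0 _ _]; rewrite mm0. Qed.

Lemma state_N m0 m st g : env m0 -> state m0 m st g -> m rN = n.
Proof. by move=> [_ ? _ _] [mm0 _ _]; rewrite mm0. Qed.

Lemma state_arc m0 m st g x y :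
  env m0 -> state m0 m st g -> m (ix x * n + ix y).*2.+16 = arc x y.
Proof.
move=> [_ _ _ <-] [mm0 _ _]; apply: mm0.
exact: kept_mat.
Qed.

Lemma state_upd m0 m st g j c :
  j \in temps -> state m0 m st g -> state m0 (upd m j c) st g.
Proof. by move=> jt; apply: state_agree; apply: agree_upd. Qed.

Lemma runs_find c m0 m st g : env m0 -> state m0 m st g ->
  runs (find_cmd c) m (n * 14 + 3) (fun m' => state m0 m' st g /\
    m' rX = opt_ix [pick x | st x == c]).
Proof.
move=> e0 S0; eapply runs_le.
  apply: runs_seq; apply: runs_block => //.
  apply: runs_post.
    apply: (@runs_scan _ _ n _ (fun i m => state m0 m st g /\
      m rX = opt_ix (ohead [seq v <- drop i (enum D) | st v == c]))).
    - exact: state_N e0 S0.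
    - by move=> i m1 [S1 _]; apply: state_one e0 S1.
    - by move=> i m1 w [S1 X1]; split=> //; apply: state_upd.
    - move=> i m1 lt_i [S1 X1] I1; have [v vi dE] := ixP lt_i.
      apply: runs_seq; apply: runs_load_status => m2 a2 q2.
      apply: runs_seq; apply: runs_block => //; set m3 := exec _ _.
      have a3 : agree [:: rP; rQ; rC] m1 m3.
        by apply: (agree_trans (agree_sub _ a2)); [exact/allP | agree_exec].
      have q3 : m3 rQ = (c - m2 rQ) + (m2 rQ - c) by [].
      have S3 : state m0 m3 st g by apply: state_agree S1;
        apply: agree_sub a3; exact/allP.
      have {}q2 : m2 rQ = st v by rewrite q2 I1 -vi; case: S1.
      rewrite {}q2 in q3.
      have I3 : m3 rI = i by rewrite a3.
      have X3 : m3 rX = m1 rX by rewrite a3.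
      clearbody m3; rewrite dE /=; apply: runs_cond => [Q_gt0|Q0].
        apply: runs_block => //=; rewrite X3 X1; split=> //; split=> //.
        by case: eqP q3 Q_gt0 => // ->; lia.
      apply: runs_block => //=; split=> //; split; first exact: state_upd.
      rewrite /upd /= I3 (state_one e0 S3); case: eqP => [|]; last lia.
      by rewrite /= vi addn1.
    - by split; [apply: state_upd | rewrite drop_oversize ?cardE].
  by move=> m' [S' X']; split=> //; rewrite X' drop0 pick_enum.
rewrite /=; lia.
Qed.

(* The vertex has index [rX - 1], see [opt_ix]. *)
Definition expand_cmd :=
  Block [:: ISub rX rX rOne; IConst rRow 0; IMove rI rX] ;;
  Loop rI (Block [:: ISub rI rI rOne; IAdd rRow rRow rN]) ;;
  Block [:: IConst rC 0] ;;
  scan (load_status ;;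
        Cond rQ skip (load_arc ;; Block [:: IAdd rC rC rQ])) ;;
  Block [:: ISub rQ rC rOne; ISub rP rOne rC; IAdd rQ rQ rP] ;;
  Cond rQ (Block [:: IConst rC 1]) (Block [:: IConst rC 4]) ;;
  scan (load_status ;;
        Cond rQ skip (load_arc ;; Cond rQ (store_status rI rC) skip)) ;;
  Block [:: IConst rC 3] ;;
  store_status rX rC.

Lemma runs_expand m0 m st g x : env m0 -> state m0 m st g -> m rX = (ix x).+1 ->
  runs expand_cmd m (n * 50 + 50) (fun m' => state m0 m' (expand st x) g).
Proof.
move=> e0 S0 X0; eapply runs_le.
  apply: runs_seq; apply: runs_block => //; set m1 := exec _ _.
  have a1 : agree [:: rX; rRow; rI] m m1 by agree_exec.
  have S1 : state m0 m1 st g by apply: state_agree S0; apply: agree_sub a1;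
    exact/allP.
  have X1 : m1 rX = ix x by rewrite /m1 /= /upd /= X0 (state_one e0 S0) subn1.
  have R1 : m1 rRow = 0 by [].
  have I1 : m1 rI = ix x by [].
  (* There is no multiplication: the offset [ix x * n] of the row of [x] is summed up in [ix x]
     rounds. *)
  clearbody m1; apply: runs_seq; apply: runs_post.
    apply: (@runs_loop _ _ _ (fun i m => [/\ m rI = i, state m0 m st g,
      m rX = ix x & m rRow = (ix x - i) * n]) (ix x)) => [i m' []|i m' lt_i
        [I' S' X' R']|] //.
      apply: runs_block => //; split.
      - by rewrite /= /upd /= I' (state_one e0 S') subn1.
      - by apply: state_upd => //; apply: state_upd.
      - by [].
      - by rewrite /= /upd /= R' (state_N e0 S') -mulSnr subnSK.
    by rewrite subnn mul0n.
  move=> m2 [_ S2 X2]; rewrite subn0 => R2 {m1 a1 S1 X1 R1 I1}.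
  apply: runs_seq; apply: runs_block => //; apply: runs_seq; apply: runs_post.
    apply: (@runs_scan _ _ n _ (fun i m => [/\ state m0 m st g,
      m rX = ix x, m rRow = ix x * n &
      m rC = count (fresh st x) (drop i (enum D))])).
    - exact: state_N e0 S2.
    - by move=> i m' [S' _ _ _]; apply: state_one e0 S'.
    - by move=> i m' w [S' X' R' C']; split=> //; apply: state_upd.
    - move=> i m3 lt_i [S3 X3 R3 C3] I3; have [v vi dE] := ixP lt_i.
      apply: runs_seq; apply: runs_load_status => m4 a4.
      have S4 : state m0 m4 st g by apply: state_agree S3;
        apply: agree_sub a4; exact/allP.
      rewrite I3 -{1}vi; have [_ _ ->] := S3 => q4.
      apply: runs_cond => [Q_gt0|Q0].
        apply: runs_block => //=; split; first by rewrite a4.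
        split; rewrite // a4 // C3 dE /= /fresh /=.
        by move: Q_gt0; rewrite q4; case: (st v) => // *; rewrite andbF.
      apply: runs_seq; apply: runs_load_arc => m5 a5.
      have S5 : state m0 m5 st g by apply: state_agree S4;
        apply: agree_sub a5; exact/allP.
      rewrite !a4 // R3 I3 -{1}vi (state_arc _ _ e0 S3) => q5.
      apply: runs_block => //=; split; first by rewrite /upd /= a5 // a4.
      split; [exact: state_upd | by rewrite /upd /= a5 // a4
        | by rewrite /upd /= a5 // a4 |].
      rewrite /upd /= q5 a5 // a4 // C3 dE /= /fresh /= -q4 Q0 eqxx andbT.
      exact: addnC.
    - split=> //; first exact: state_upd.
      by rewrite drop_oversize // cardE.
  rewrite drop0 => m3 [S3 X3 R3 C3] {m2 S2 X2 R2}.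
  have {}C3 : m3 rC = #|fresh st x|.
    by rewrite C3 cardE -size_filter enumT.
  apply: runs_seq; apply: runs_block => //; set m4 := exec _ _.
  have a4 : agree [:: rP; rQ] m3 m4 by agree_exec.
  have S4 : state m0 m4 st g by apply: state_agree S3; apply: agree_sub a4;
    exact/allP.
  have q4 : m4 rQ = (#|fresh st x| - 1) + (1 - #|fresh st x|).
    by rewrite /m4 /= /upd /= (state_one e0 S3) C3.
  clearbody m4; set nc := child_status #|fresh st x|.
  apply: runs_seq; apply: (@runs_post _ _ _ (fun m => [/\ state m0 m st g,
      m rX = ix x, m rRow = ix x * n & m rC = nc])).
    apply: runs_cond => [Q_gt0|Q0]; apply: runs_block => //; split.
    all: rewrite /= /upd /= ?a4 //; try exact: state_upd.
      by rewrite /nc /child_status; case: eqP => // E; rewrite E in q4;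
        rewrite q4 in Q_gt0.
    by rewrite /nc /child_status; case: eqP => // E; lia.
  move=> m5 [S5 X5 R5 C5] {m3 m4 S3 X3 R3 C3 a4 S4 q4}.
  (* The statuses once the indices from [i] on are updated. Updating in place is safe, as freshness
     of [v] depends on no other status than its own, unchanged until its turn. *)
  pose sti i v := if (i <= ix v) && fresh st x v then nc else st v.
  apply: runs_seq; apply: runs_post.
    apply: (@runs_scan _ _ n _ (fun i m => [/\ state m0 m (sti i) g,
      m rX = ix x, m rRow = ix x * n & m rC = nc])).
    - exact: state_N e0 S5.
    - by move=> i m' [S' _ _ _]; apply: state_one e0 S'.
    - by move=> i m' w [S' X' R' C']; split=> //; apply: state_upd.
    - move=> i m1 lt_i [S1 X1 R1 C1] I1; have [v vi _] := ixP lt_i.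
      have stiE w : w != v -> sti i w = sti i.+1 w.
        move=> wv; rewrite /sti [i <= _]leq_eqVlt -vi eq_sym.
        by rewrite (inj_eq ix_inj) (negPf wv).
      have stiv : sti i.+1 v = st v by rewrite /sti vi ltnn.
      have nofresh : ~~ fresh st x v -> sti i.+1 =1 sti i.
        move=> nf w; have [->|/stiE //] := eqVneq w v.
        by rewrite /sti (negPf nf) !andbF.
      apply: runs_seq; apply: runs_load_status => m2 a2.
      have S2 : state m0 m2 (sti i.+1) g.
        by apply: state_agree S1; apply: agree_sub a2; exact/allP.
      rewrite I1 -{1}vi; have [_ _ ->] := S1; rewrite stiv => q2.
      apply: runs_cond => [Q_gt0|Q0].
        apply: runs_block => //=; split; first by rewrite a2.
        split; rewrite ?a2 //; apply: eq_state S2; apply: nofresh.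
        by rewrite /fresh /= -q2 eqn0Ngt Q_gt0 andbF.
      apply: runs_seq; apply: runs_load_arc => m3 a3.
      have S3 : state m0 m3 (sti i.+1) g.
        by apply: state_agree S2; apply: agree_sub a3; exact/allP.
      rewrite !a2 // R1 I1 -{1}vi (state_arc _ _ e0 S1) => q3.
      have fE : fresh st x v = arc x v by rewrite /fresh /= -q2 Q0 eqxx andbT.
      apply: runs_cond => [Q_gt0|Q0']; last first.
        apply: runs_block => //=; split; first by rewrite a3 // a2.
        split; rewrite ?a3 ?a2 //; apply: eq_state S3; apply: nofresh.
        by rewrite fE -eqb0 -q3 Q0'.
      apply: runs_store_status => // m4;
        rewrite a3 // a2 // I1 -{1 2}vi => a4 q4.
      split; first by rewrite a4 // a3 // a2.
      split; rewrite ?a4 ?a3 ?a2 //.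
      apply: eq_state (state_store a4 q4 S3) => w; rewrite /set_status.
      case: (w =P v) => [->|/eqP/stiE->//].
      rewrite a3 // a2 // C1 /sti vi leqnn fE.
      by move: Q_gt0; rewrite q3 lt0b => ->.
    - split=> //; apply: eq_state S5 => v.
      by rewrite /sti leqNgt ix_lt.
  move=> m6 [S6 X6 R6 C6].
  apply: runs_seq; apply: runs_block => //; set m7 := exec _ _.
  have X7 : m7 rX = ix x by [].
  have C7 : m7 rC = 3 by [].
  have S7 : state m0 m7 (sti 0) g by apply: state_upd.
  clearbody m7; apply: runs_store_status => // m8; rewrite X7 C7 => a8 q8.
  exact: eq_state (state_store a8 q8 S7).
by rewrite /=; have := ix_lt x; move: (ix x) #|D| => a b; lia.
Qed.

(** The low bit of the guess is what remains after subtracting its half twice. *)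
Definition decide_cmd :=
  Block [:: ISub rX rX rOne; IHalf rQ rBits; ISub rP rBits rQ; ISub rP rP rQ;
            IMove rBits rQ] ;;
  Cond rP (Block [:: IConst rC 4]) (Block [:: IConst rC 2]) ;;
  store_status rX rC.

Lemma runs_decide m0 m st g x : env m0 -> state m0 m st g -> m rX = (ix x).+1 ->
  runs decide_cmd m 13 (fun m' =>
    state m0 m' (set_status st x (if odd g then 4 else 2)) g./2).
Proof.
move=> e0 S0 X0; have [k0 g0 st0] := S0; eapply runs_le.
  apply: runs_seq; apply: runs_block => //; set m1 := exec _ _.
  have a1 : agree [:: rX; rQ; rP; rBits] m m1 by agree_exec.
  have X1 : m1 rX = ix x by rewrite /m1 /= /upd /= X0 (state_one e0 S0) subn1.
  have P1 : m1 rP = odd g.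
    by rewrite /m1 /= /upd /= g0 -{1}(odd_double_half g) -subnDA addnn addnK.
  have S1 : state m0 m1 st g./2.
    split=> [j kj||v]; [|by rewrite /m1 /= /upd /= g0|by rewrite a1].
    rewrite a1 ?k0 //; apply: contraL kj; rewrite !inE.
    by case/or4P=> /eqP->.
  clearbody m1; apply: runs_seq.
  apply: (@runs_post _ _ _ (fun m => [/\ state m0 m st g./2, m rX = ix x &
      m rC = if odd g then 4 else 2])).
    apply: runs_cond; rewrite P1; case: (odd g) => // _;
      by apply: runs_block => //; split=> //; apply: state_upd.
  move=> m2 [S2 X2 C2]; apply: runs_store_status => // m3;
    rewrite X2 C2 => a3 q3.
  exact: state_store a3 q3 S2.
by [].
Qed.

Definition branch_cmd :=
  find_cmd 4 ;; Cond rX expand_cmd (find_cmd 1 ;; Cond rX decide_cmd skip).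

Lemma runs_branch m0 m s : env m0 -> state m0 m s.1 s.2 ->
  runs branch_cmd m (n * 80 + 80) (fun m' =>
    state m0 m' (branch s).1 (branch s).2).
Proof.
move=> e0 S0; eapply runs_le.
  apply: runs_seq; apply: runs_post (runs_find 4 e0 S0) _ => m1 [S1 X1].
  rewrite /branch; case: pickP X1 => [x _|_] X1.
    apply: runs_cond => [_|]; last by rewrite X1.
    exact: runs_expand X1.
  apply: runs_cond => [|_]; first by rewrite X1.
  apply: runs_seq; apply: runs_post (runs_find 1 e0 S1) _ => m2 [S2 X2].
  case: pickP X2 => [x _|_] X2.
    apply: runs_cond => [_|]; last by rewrite X2.
    exact: runs_decide X2.
  apply: runs_cond => [|_]; first by rewrite X2.
  exact: runs_block.
rewrite /=; lia.
Qed.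

End Machine.

(** * Trials, and the search over roots and guesses *)

Section Search.
Variables (D : digraph) (k : nat).
Implicit Types (st : D -> nat) (x y v w : D) (m : memory) (g : nat).
Local Notation n := #|D|.
Local Notation ix := (@ix D).
Local Notation env := (@env D k).

(** The status registers must be cleared: they hold the outcome of the previous trial or, the first
    time, possibly remains of the input. *)
Definition grow_cmd :=
  scan (Block [:: IConst rC 0] ;; store_status rI rC) ;;
  store_status rRoot rOne ;;
  Block [:: IMove rBits rGuess; IMove rStep rNStep] ;;
  Loop rStep (Block [:: ISub rStep rStep rOne] ;; branch_cmd).

Definition count_cmd :=
  Block [:: IConst rC 0] ;;
  scan (load_status ;;
        Cond rQ (Block [:: IConst rP 3; ISub rX rQ rP; ISub rQ rP rQ;
                           IAdd rQ rQ rX] ;;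
                 Cond rQ (Block [:: IAdd rC rC rOne]) skip)
             skip).

Definition trial_cmd :=
  grow_cmd ;; count_cmd ;;
  Block [:: ISub rQ rK rC] ;; Cond rQ skip (Block [:: IConst rRes 1]).

Definition outer := [:: rRes; rGuess; rRoot; rNGuess; rNStep].

Lemma outer_kept j : j \in outer -> kept j.
Proof. by move: j; apply/allP. Qed.

Lemma runs_grow m r :
    env m -> m rRoot = ix r ->
  runs grow_cmd m (m rNStep * (n * 80 + 90) + (n * 10 + 10)) (fun m' =>
    [/\ env m', forall j, j \in outer -> m' j = m j &
      has_status m' (iter (m rNStep) (@branch D) (init_status r, m rGuess)).1]).
Proof.
move=> em mr; eapply runs_le.
  apply: runs_seq; apply: runs_post.
    apply: (@runs_scan _ _ n _ (fun i m' => (forall j, kept j -> m' j = m j) /\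
      forall v, i <= ix v -> m' (ix v).*2.+17 = 0)).
    - by case: em.
    - by move=> i m' [km' _]; rewrite km' //; case: em.
    - move=> i m' c [km' sm']; split=> [j kj|v iv]; last exact: sm'.
      rewrite -km' // /upd; case: eqP => // j4; by rewrite j4 in kj.
    - move=> i m1 lt_i [k1 s1] I1; have [v vi _] := ixP lt_i.
      apply: runs_seq; apply: runs_block => //; set m1' := exec _ _.
      have {}I1 : m1' rI = ix v by rewrite vi.
      have C1 : m1' rC = 0 by [].
      have {}k1 j : kept j -> m1' j = m j.
        by move=> kj; rewrite -k1 // /m1' /= /upd; case: eqP kj => [->|].
      have {}s1 w : i < ix w -> m1' (ix w).*2.+17 = 0 by apply: s1.
      clearbody m1'; apply: runs_store_status => // m2.
      rewrite I1 C1 => a2 q2; split; first by rewrite a2 // I1.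
      split=> [j kj|w le_iw].
        rewrite a2 ?k1 //; apply: contraL kj; rewrite !inE => /or3P[] /eqP-> //.
        by rewrite kept_status.
      have [->|wv] := eqVneq w v; first exact: q2.
      rewrite a2; last first.
        rewrite !inE /= -!mul2n !eqSS eqn_mul2l /=.
        by rewrite (inj_eq (@ix_inj D)).
      rewrite s1 // ltn_neqAle le_iw andbT -vi.
      by rewrite (inj_eq (@ix_inj D)) eq_sym.
    - by split=> // v; rewrite leqNgt ix_lt.
  move=> m1 [k1 s1]; have e1 : env m1 by apply: env_kept em k1.
  have S1 : state m m1 (fun _ : D => 0) (m1 rBits).
    by split=> // v; apply: s1.
  apply: runs_seq; apply: runs_store_status => // m2.
  rewrite k1 // mr => a2 q2; have S2 := state_store a2 q2 S1.
  have [_ _ e11 _] := e1; rewrite e11 in S2.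
  apply: runs_seq; apply: runs_block => //; set m3 := exec _ _.
  have k3 j : j \in outer -> m3 j = m j.
    move=> jo; have [km2 _ _] := S2; rewrite -km2; last exact: outer_kept.
    by rewrite /m3 /= /upd; case: eqP jo => [->|_] //; case: eqP => [->|].
  have e3 : env m3.
    have [km2 _ _] := S2; have [mK mN m1' mA] := env_kept em km2.
    split; rewrite // => x y; exact: mA.
  have st3 : has_status m3 (init_status r) by have [_ _ h] := S2.
  have b3 : m3 rBits = m rGuess.
    by have [km2 _ _] := S2; rewrite /m3 /= /upd /= km2.
  have t3 : m3 rStep = m rNStep.
    by have [km2 _ _] := S2; rewrite /m3 /= /upd /= km2.
  clearbody m3; pose s0 : (D -> nat) * nat := (init_status r, m rGuess).
  apply: runs_post.
    apply: (@runs_loop _ _ _ (fun i m' => [/\ m' rStep = i, env m',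
        forall j, j \in outer -> m' j = m j,
        m' rBits = (iter (m rNStep - i) (@branch D) s0).2
      & has_status m' (iter (m rNStep - i) (@branch D) s0).1]) (m rNStep));
      [by move=> i m' [] | | by rewrite subnn].
    move=> i m4 lt_i [t4 e4 k4 b4 st4].
    apply: runs_seq; apply: runs_block => //; set m5 := exec _ _.
    have e5 : env m5 by case: e4 => *; split.
    have t5 : m5 rStep = i.
      by have [_ _ e41 _] := e4; rewrite /m5 /= /upd /= t4 e41 subn1.
    have k5 j : j \in outer -> m5 j = m j.
      by move=> jo; rewrite -k4 // /m5 /= /upd; case: eqP jo => [->|].
    have S5 : state m5 m5 (iter (m rNStep - i.+1) (@branch D) s0).1
        (iter (m rNStep - i.+1) (@branch D) s0).2 by split.
    clearbody m5; apply: runs_post (runs_branch e5 S5) _ => m6.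
    rewrite -iterS subnS prednK ?subn_gt0 // => -[k6 b6 st6].
    split=> //; [by rewrite k6 | exact: env_kept k6 |].
    by move=> j jo; rewrite k6 ?k5 //; apply: outer_kept.
  by move=> m4 [_ e4 k4 _]; rewrite subn0; split.
rewrite /=; lia.
Qed.

Lemma runs_count m0 m st g : env m0 -> state m0 m st g ->
  runs count_cmd m (n * 20 + 10) (fun m' => state m0 m' st g /\ m' rC =
    nleaves st).
Proof.
move=> e0 S0; eapply runs_le.
  apply: runs_seq; apply: runs_block => //.
  apply: runs_post.
    apply: (@runs_scan _ _ n _ (fun i m => state m0 m st g /\
      m rC = count [pred v | leaf_status (st v)] (drop i (enum D)))).
    - exact: state_N e0 S0.
    - by move=> i m1 [S1 _]; apply: state_one e0 S1.
    - by move=> i m1 w [S1 X1]; split=> //; apply: state_upd.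
    - move=> i m1 lt_i [S1 C1] I1; have [v vi dE] := ixP lt_i.
      apply: runs_seq; apply: runs_load_status => m2 a2.
      have S2 : state m0 m2 st g by apply: state_agree S1;
        apply: agree_sub a2; exact/allP.
      rewrite I1 -{1}vi; have [_ _ ->] := S1 => q2.
      rewrite dE /=; apply: runs_cond => [Q_gt0|Q0]; last first.
        apply: runs_block => //=; rewrite !a2 // C1; split=> //; split=> //.
        by rewrite -q2 Q0.
      apply: runs_seq; apply: runs_block => //; set m3 := exec _ _.
      have a3 : agree [:: rP; rQ; rX] m2 m3 by agree_exec.
      have q3 : m3 rQ = (3 - m2 rQ) + (m2 rQ - 3) by [].
      have S3 : state m0 m3 st g by apply: state_agree S2;
        apply: agree_sub a3; exact/allP.
      clearbody m3; apply: runs_cond => [Q3|Q3]; apply: runs_block => //=.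
        rewrite /upd /= !a3 // !a2 // C1; split=> //; split;
          first exact: state_upd.
        rewrite (state_one e0 S1) addnC; congr (_ + _).
        by have -> : leaf_status (st v) by rewrite /leaf_status -q2; lia.
      rewrite !a3 // !a2 // C1; split=> //; split=> //.
      by have -> : leaf_status (st v) = false by rewrite /leaf_status -q2; lia.
    - by split; [apply: state_upd | rewrite drop_oversize ?cardE].
  move=> m' [S' ->]; split=> //; rewrite drop0 /nleaves.
  by rewrite cardE -size_filter enumT.
rewrite /=; lia.
Qed.

Lemma runs_trial m r :
    env m -> m rRoot = ix r -> m rNStep = k + k + n ->
  runs trial_cmd m ((k + k + n) * (n * 80 + 90) + (n * 30 + 25)) (fun m' =>
    [/\ env m', forall j, j \in behead outer -> m' j = m j &
      m' rRes = if accepts k r (m rGuess) then 1 else m rRes]).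
Proof.
move=> em mr mS; eapply runs_le.
  apply: runs_seq; apply: runs_post (runs_grow em mr) _ => m1 [e1 k1 st1].
  apply: runs_seq.
  have S1 : state m1 m1 (iter (m rNStep) (@branch D) (init_status r, m
    rGuess)).1
    (m1 rBits) by split.
  apply: runs_post (runs_count e1 S1) _ => m2 [S2 C2].
  have [k2 _ _] := S2; have e2 := env_kept e1 k2.
  have {}k2 j : j \in outer -> m2 j = m j.
    by move=> jo; rewrite k2 ?k1 //; apply: outer_kept.
  apply: runs_seq; apply: runs_block => //.
  rewrite /accepts -mS -C2; have [K2 N2 O2 A2] := e2.
  apply: runs_cond => [Q_gt0|Q0]; apply: runs_block => //=.
    move: Q_gt0; rewrite /exec /= {1}/upd /= K2 subn_gt0 => lt_C.
    rewrite leqNgt lt_C /=; split; rewrite /upd //=; last exact: k2.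
    move=> j jo; rewrite -k2; last by rewrite mem_behead.
    by case: eqP jo => [->|].
  move: Q0; rewrite /exec /= {1}/upd /= K2 => /eqP; rewrite subn_eq0 => ->.
  split; rewrite /upd //= => j jo; rewrite -k2; last by rewrite mem_behead.
  by case: eqP jo => [->|] //; case: eqP => [->|].
by rewrite /= mS; move: #|D| ((k + k + n) * _) => b a; lia.
Qed.

Definition search_cmd :=
  Block [:: IConst rRes 0; IMove rRoot rN] ;;
  Loop rRoot (
    Block [:: ISub rRoot rRoot rOne; IMove rGuess rNGuess] ;;
    Loop rGuess (Block [:: ISub rGuess rGuess rOne] ;; trial_cmd)) ;;
  Block [:: IMove rK rRes].

Lemma runs_search m G :
    env m -> m rNStep = k + k + n -> m rNGuess = G ->
  runs search_cmd m
    (n * (G * ((k + k + n) * (n * 80 + 90) + (n * 30 + 28)) + 5) + 4)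
    (fun m' => m' rK =
      has (fun r : D => has (accepts k r) (iota 0 G)) (enum D)).
Proof.
move=> em mS mG; eapply runs_le.
  apply: runs_seq; apply: runs_block => //; set m1 := exec _ _.
  have e1 : env m1 by case: em => *; split.
  have R1 : m1 rRoot = n by case: em.
  have {}mS : m1 rNStep = k + k + n by [].
  have {}mG : m1 rNGuess = G by [].
  have res1 : m1 rRes = 0 by [].
  clearbody m1; apply: runs_seq; apply: runs_post.
    apply: (@runs_loop _ _ _ (fun i m => [/\ m rRoot = i, env m,
      m rNStep = k + k + n, m rNGuess = G &
      m rRes = has (fun r : D => has (accepts k r) (iota 0 G))
        (drop i (enum D))]) n).
    - by move=> i m2 [].
    - move=> i m2 lt_i [R2 e2 S2 G2 res2]; have [r ri dE] := ixP lt_i.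
      apply: runs_seq; apply: runs_block => //; set m3 := exec _ _.
      have e3 : env m3 by case: e2 => *; split.
      have R3 : m3 rRoot = ix r.
        by have [_ _ e21 _] := e2; rewrite /m3 /= /upd /= R2 e21 subn1 ri.
      have {}S2 : m3 rNStep = k + k + n by [].
      have {}G2 : m3 rNGuess = G by [].
      have {}res2 : m3 rRes = has (fun r' : D => has (accepts k r') (iota 0 G))
        (drop i.+1 (enum D)) by [].
      have g3 : m3 rGuess = G by [].
      (* [b0] is the verdict on the roots of larger index; for [r], the guesses from [j] to [G - 1]
         have been tried. *)
      clearbody m3; set b0 := has _ _ in res2; apply: runs_post.
        apply: (@runs_loop _ _ _ (fun j m => [/\ m rGuess = j, env m,
          m rRoot = ix r, m rNStep = k + k + n /\ m rNGuess = G &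
          m rRes = has (accepts k r) (iota j (G - j)) || b0]) G).
        - by move=> j m4 [].
        - move=> j m4 lt_j [g4 e4 R4 [S4 G4] res4].
          apply: runs_seq; apply: runs_block => //; set m5 := exec _ _.
          have e5 : env m5 by case: e4 => *; split.
          have g5 : m5 rGuess = j.
            by have [_ _ e41 _] := e4; rewrite /m5 /= /upd /= g4 e41 subn1.
          have R5 : m5 rRoot = ix r by [].
          have S5 : m5 rNStep = k + k + n by [].
          have G5 : m5 rNGuess = G by [].
          have res5 : m5 rRes = m4 rRes by [].
          clearbody m5; apply: runs_post (runs_trial e5 R5 S5) _.
          move=> m6 [e6 k6 res6]; split=> //; try by rewrite !k6.
          rewrite res6 g5 res5 res4 subnS -(prednK (n := G - j)) ?subn_gt0 //=.
          by case: ifP.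
        - by rewrite subnn.
      move=> m4 [_ e4 R4 [S4 G4] res4]; split=> //; first by rewrite R4.
      by rewrite res4 dE /= subn0.
    - by split=> //; rewrite drop_oversize ?cardE.
  move=> m2 [_ _ _ _ res2]; apply: runs_block => //.
  by rewrite /= /upd /= res2 drop0.
rewrite /=; move: #|D| ((k + k + n) * _) => b a.
have : b * (2 + (G * (1 + (a + (b * 30 + 25))).+2).+1).+2 <=
  b * (G * (a + (b * 30 + 28)) + 5).
  by rewrite leq_mul2l; apply/orP; right; lia.
lia.
Qed.

End Search.

(** * Rearranging the input *)

Definition pack l := flatten [seq [:: IAdd 0 0 0; IAdd 0 0 j] | j <- l].

(** Input register [j] holds the matrix entry of index [j - 2], whose place is
    [2 (j - 2) + 16 = 2 j + 12]. Halving yields the last packed bit first, so the list is to be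
    given in reverse. *)
Definition unpack l := flatten
  [seq [:: IHalf rI rK; ISub rP rK rI; ISub rP rP rI; IMove rK rI;
           IMove j.*2.+4.+4.+4 rP] | j <- l].

(** Horner's rule in base 2. The initial value, here the parameter, is the high-order part and
    reappears once all bits are removed. *)
Definition packed (b : nat -> nat) := foldl (fun a j => a.*2 + b j).

Lemma exec_pack b l m :
    0 \notin l -> (forall j, j \in l -> m j = b j) ->
  exec m (pack l) 0 = packed b (m 0) l /\
  (forall j, j != 0 -> exec m (pack l) j = m j).
Proof.
elim: l m => [|i l IH] m //; rewrite inE negb_or eq_sym => /andP[i0 l0] mb.
rewrite /pack /= -/(pack l); set m1 := upd _ _ _.
have m1E j : j != 0 -> m1 j = m j.
  by move=> j0; rewrite /m1 /upd (negPf j0).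
have m10 : m1 0 = (m 0).*2 + b i.
  by rewrite /m1 /upd /= (negPf i0) addnn (mb i) ?mem_head.
clearbody m1; have [//|j jl|-> E2] := IH m1; rewrite ?m10 //.
  by rewrite m1E ?mb ?inE ?jl ?orbT //; apply: contraNneq l0 => <-.
by split=> // j j0; rewrite E2 ?m1E.
Qed.

Lemma exec_unpack b a l m :
    uniq l -> (forall j, j \in l -> b j <= 1) -> m 0 = packed b a l ->
  let m' := exec m (unpack (rev l)) in
  [/\ m' 0 = a, forall j, j \in l -> m' j.*2.+4.+4.+4 = b j &
    forall j, j \notin [:: rK; rI; rP] ->
      (forall i, i \in l -> j != i.*2.+4.+4.+4) -> m' j = m j].
Proof.
elim/last_ind: l m => [|l x IH] m //=; rewrite rcons_uniq => /andP[xl Ul] b1.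
rewrite /packed foldl_rcons -/(packed b a l) => m0; rewrite rev_rcons.
rewrite /unpack /= -/(unpack (rev l)).
have bx : b x <= 1 by apply: b1; rewrite mem_rcons mem_head.
have h : ((packed b a l).*2 + b x)./2 = packed b a l.
  by rewrite addnC; case: (b x) bx => [|[|]] // _;
    rewrite ?doubleK //= uphalf_double.
set m1 := upd _ _.+4 _.
have m10 : m1 0 = packed b a l by rewrite /m1 /upd /= m0 h.
have m1x : m1 x.*2.+4.+4.+4 = b x.
  by rewrite /m1 /upd /= eqxx m0 h -subnDA addnn addKn.
have m1E j : j \notin [:: rK; rI; rP] -> j != x.*2.+4.+4.+4 -> m1 j = m j.
  rewrite !inE !negb_or => /and3P[j0 j4 j5] jx.
  by rewrite /m1 /upd (negPf jx) (negPf j0) (negPf j4) (negPf j5).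
clearbody m1; have [//|j jl|E0 El Er] := IH m1 _ _ m10.
  by apply: b1; rewrite mem_rcons inE jl orbT.
have dbl_inj i j : i != j -> i.*2.+4.+4.+4 != j.*2.+4.+4.+4.
  by move=> ij; rewrite -!mul2n !eqSS eqn_mul2l.
split=> // [j|j js jl].
  rewrite mem_rcons inE => /predU1P[->|/El //]; rewrite Er // => i il.
  by apply: dbl_inj; apply: contraNneq xl => ->.
rewrite Er ?m1E // => [|i il]; apply: jl; rewrite mem_rcons inE ?eqxx //.
by rewrite il orbT.
Qed.

Lemma nth_allpairs (S T R : Type) (f : S -> T -> R) x0 y0 z0 s t i j :
    i < size s -> j < size t ->
  nth z0 [seq f x y | x <- s, y <- t] (i * size t + j) =
  f (nth x0 s i) (nth y0 t j).
Proof.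
elim: s i => [|x s IH] [|i] //= lt_i lt_j; rewrite nth_cat size_map.
  by rewrite mul0n add0n lt_j (nth_map y0).
rewrite mulSn -addnA ltnNge leq_addr /= addKn; exact: IH.
Qed.

Section Setup.
Variables (D : digraph) (k : nat).
Local Notation n := #|D|.
Local Notation ix := (@ix D).
Local Notation env := (@env D k).

Definition adj := nth 0 [seq nat_of_bool (arc x y) | x <- enum D, y <- enum D].

(** Past the end of the matrix the default 0 applies; this matters for orders below 4, where
    registers 2 to 15 reach beyond the input. *)
Lemma adj_le1 i : adj i <= 1.
Proof.
rewrite /adj; set s := (X in nth 0 X).
have [lt_i|le_i] := ltnP i (size s); last by rewrite nth_default.
by have /allpairsP[[x y] [_ _ ->]] := mem_nth 0 lt_i; case: (arc _ _).
Qed.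

Lemma adj_arc (x y : D) : adj (ix x * n + ix y) = arc x y.
Proof.
rewrite /adj cardE (nth_allpairs _ x x) ?index_mem ?mem_enum //.
by rewrite !nth_index ?mem_enum.
Qed.

(* The variables first have to be freed: registers 2 to 15, which hold bits of
   the matrix, are packed into the binary expansion of register 0. The rest of
   the matrix is moved starting from its end, since source and target
   overlap. *)
Definition setup_cmd :=
  Block (pack (iota 2 14)) ;;
  Block [:: IConst rOne 1; IConst rRes 0; IMove rI rN] ;;
  Loop rI (Block [:: ISub rI rI rOne; IAdd rRes rRes rN]) ;;
  Block [:: IConst rP 14; ISub rI rRes rP] ;;
  Loop rI (Block [:: ISub rI rI rOne; IConst rQ 16; IAdd rP rI rQ; ILoad rQ rP;
                     IAdd rP rI rI; IConst rX 44; IAdd rP rP rX;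
                       IStore rP rQ]) ;;
  Block (unpack (rev (iota 2 14))) ;;
  Block [:: IConst rNGuess 1; IMove rI rK] ;;
  Loop rI (Block [:: ISub rI rI rOne; IAdd rNGuess rNGuess rNGuess;
                     IAdd rNGuess rNGuess rNGuess]) ;;
  Block [:: IAdd rNStep rK rK; IAdd rNStep rNStep rN].

Lemma runs_setup :
  runs setup_cmd (nth 0 (encode D k)) (n * n * 10 + n * 4 + k * 5 + 120)
    (fun m => [/\ env m, m rNStep = k + k + n & m rNGuess = 2 ^ (k + k)]).
Proof.
set w := nth 0 _; set pk := packed w k (iota 2 14).
have wE j : w j.+2 = adj j by [].
eapply runs_le.
  apply: runs_seq; apply: runs_block => //.
  have [//|//|] := @exec_pack w (iota 2 14) w.
  move: (exec w _) => m1 E0 E1; rewrite -/pk in E0.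
  apply: runs_seq; apply: runs_block => //; set m2 := exec _ _.
  have a2 : agree [:: 2; 3; 4] m1 m2 by agree_exec.
  have [I2 O2 R2] : [/\ m2 rI = n, m2 rOne = 1 & m2 rRes = 0].
    by split=> //; rewrite /m2 /= /upd /= E1.
  clearbody m2; apply: runs_seq; apply: runs_post.
    apply: (@runs_loop _ _ _ (fun i m => [/\ m rI = i, agree [:: 3; 4] m2 m &
      m rRes = (n - i) * n]) n) => [i m []|i m lt_i [I3 a3 R3]|] //.
      apply: runs_block => //; split.
      - by rewrite /= /upd /= I3 a3 // O2 subn1.
      - by apply: agree_upd => //; apply: agree_upd.
      - rewrite /= /upd /= R3 a3 // a2 // E1 // -mulSnr subnSK //.
    by rewrite subnn.
  move=> m3 [_ a3]; rewrite subn0 => R3.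
  apply: runs_seq; apply: runs_block => //; set m4 := exec _ _.
  have a4 : agree [:: 4; 5] m3 m4 by agree_exec.
  have I4 : m4 rI = n * n - 14 by rewrite /m4 /= /upd /= R3.
  have O4 : [/\ m4 0 = pk, m4 1 = n & m4 2 = 1].
    by rewrite !a4 // !a3 // O2 (a2 0) // (a2 1) // E0 E1.
  have W4 c : m4 c.+16 = w c.+16 by rewrite a4 // a3 // a2 // E1.
  clearbody m4 => {m1 m2 m3 E0 E1 a2 a3 a4 I2 O2 R2 R3}.
  (* Register [c + 16] holds the entry of index [c + 14], bound for [2 (c + 14) + 16 = 44 + 2 c].
     This is larger than every source still to be read, so none is overwritten. *)
  apply: runs_seq; apply: runs_post.
    apply: (@runs_loop _ _ _ (fun i m => [/\ m rI = i,
      [/\ m 0 = pk, m 1 = n & m 2 = 1],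
      forall c, c < i -> m c.+16 = w c.+16 &
      forall c, i <= c < n * n - 14 -> m (44 + c.*2) = w c.+16]) (n * n - 14)).
    - by move=> i m [].
    - move=> i m lt_i [I5 [m0 mN mO] low high].
      apply: runs_block => //; set m5 := exec _ _.
      have m5E j : j \notin [:: 4; 5; 6; 7; 44 + i.*2] -> m5 j = m j.
        rewrite !inE !negb_or => /and5P[j4 j5 j6 j7 j44].
        rewrite /m5 /= /upd /= I5 mO subn1 addnn [_ + 44]addnC (negPf j44).
        by rewrite (negPf j4) (negPf j5) (negPf j6) (negPf j7).
      have m5i : m5 (44 + i.*2) = w i.+16.
        rewrite /m5 /= /upd /= I5 mO subn1 addnn [_ + 44]addnC eqxx.
        rewrite [i + 16]addnC; exact: low.
      have I5' : m5 4 = i.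
        by rewrite /m5 /= /upd /= I5 mO subn1 /= addnn addnC.
      clearbody m5; split=> // [|c lt_c|c].
      + by rewrite !m5E.
      + rewrite m5E ?low //; first lia.
        by rewrite !inE; lia.
      + have [->|ci] := eqVneq c i; first by rewrite m5i.
        move=> hc; rewrite m5E ?high //; first lia.
        by rewrite !inE; lia.
    - by split=> // c; lia.
  move=> m5 [_ [m50 m5N m5O] _ high].
  apply: runs_seq; apply: runs_block => //; cbv zeta.
  have [//|j|//|] := @exec_unpack w k (iota 2 14) m5.
    by rewrite mem_iota; case: j => [|[|j]] // _; rewrite wE adj_le1.
  move: (exec m5 _) => m6 U0 Ul Ur.
  have e6 : env m6.
    split=> //.
    - by rewrite Ur.
    - by rewrite Ur.
    - move=> x y; rewrite -adj_arc; set idx := _ + _.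
      have lt_idx : idx < n * n.
        have := ix_lt x; have := ix_lt y; rewrite /idx.
        move: (ix x) (ix y) #|D| => a b d lt_b lt_a.
        by apply: leq_trans (leq_mul lt_a (leqnn d)); rewrite mulSn; lia.
      (* The first 14 entries come from the packed register, the others from the move. The targets
         of [unpack] end at 42, below those of the move. *)
      have [lt14|ge14] := ltnP idx 14.
        have -> : idx.*2.+16 = idx.+2.*2.+4.+4.+4 by rewrite !doubleS.
        by rewrite Ul ?wE // mem_iota; lia.
      have -> : idx.*2.+16 = 44 + (idx - 14).*2 by lia.
      rewrite Ur => [|//|i].
      + by rewrite high ?[_ - 14]/=; [rewrite wE; congr adj; lia | lia].
      + by rewrite mem_iota; lia.
  clear -e6.
  apply: runs_seq; apply: runs_block => //; set m7 := exec _ _.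
  have e7 : env m7 by case: e6 => *; split.
  have [I7 G7] : m7 rI = k /\ m7 rNGuess = 1 by case: e6.
  clearbody m7; apply: runs_seq; apply: runs_post.
    apply: (@runs_loop _ _ _ (fun i m => [/\ m rI = i, env m &
      m rNGuess = 2 ^ ((k - i) + (k - i))]) k) => [i m []|i m lt_i [I8 e8
        G8]|] //.
      have [_ _ e81 _] := e8; apply: runs_block => //; split.
      - by rewrite /= /upd /= I8 e81 subn1.
      - by case: e8 => *; split.
      - rewrite /= /upd /= G8 -(subnSK lt_i) addSn addnS !expnS; lia.
    by rewrite subnn.
  move=> m8 [_ e8]; rewrite subn0 => G8.
  apply: runs_block => //; split=> //.
  by have [K8 N8 _ _] := e8; rewrite /= /upd /= K8 N8.
rewrite /=; lia.
Qed.

End Setup.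

(** * Correctness and running time *)

Lemma has_accepts (D : digraph) k : 0 < k ->
  has (fun r : D => has (accepts k r) (iota 0 (2 ^ (k + k)))) (enum D) =
  (k <= ell D).
Proof.
move=> k_gt0; apply/hasP/idP => [[r _ /hasP[g _]]|]; first exact: accepts_sound.
move=> /(accepts_complete k_gt0)[r [g [lt_g acc]]].
exists r; first by rewrite mem_enum.
by apply/hasP; exists g; rewrite ?mem_iota.
Qed.

(** The main term is [n] roots times [G] guesses times [k + k + n] steps times [O(n)] per step.
    Bounding [k + k + n] by [G * N] produces [G * G] and [N ^ 3]. *)
Lemma time_bound k n : 0 < k ->
  n * n * 10 + n * 4 + k * 5 + 120 +
  (n * (2 ^ (k + k) * ((k + k + n) * (n * 80 + 90) + (n * 30 + 28)) + 5) + 4) <=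
  400 * 2 ^ (4 * k) * maxn 1 n ^ 3.
Proof.
move=> k_gt0; set N := maxn 1 n; set G := 2 ^ (k + k).
have leN : n <= N by rewrite leq_maxr.
have N_gt0 : 0 < N by rewrite leq_max.
have leG : k + k < G by rewrite ltn_expl.
have -> : 2 ^ (4 * k) = G * G by rewrite -expnD; congr (2 ^ _); lia.
have -> : N ^ 3 = N * N * N by rewrite !expnS expn0; lia.
(* The constant is [228 = (80 + 90) + (30 + 28)]; the lower-order terms fit in the remaining room up
   to 400. *)
have h1 : (k + k + n) * (n * 80 + 90) + (n * 30 + 28) <= 228 * (G * (N * N)).
  have h2 : k + k + n <= G * N.
    have : (k + k).+1 * N <= G * N by rewrite leq_mul2r leG orbT.
    have : (k + k) * 1 <= (k + k) * N by rewrite leq_mul2l N_gt0 orbT.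
    by rewrite mulSn; lia.
  have := leq_mul h2 (_ : n * 80 + 90 <= 170 * N).
  move=> /(_ ltac:(lia)) h3.
  have : 1 * (N * 1) <= G * (N * N) by rewrite !leq_mul //; lia.
  lia.
have h4 : n * (G * ((k + k + n) * (n * 80 + 90) + (n * 30 + 28))) <=
    N * (G * (228 * (G * (N * N)))) by rewrite !leq_mul.
have h5 : n * n <= N * N by rewrite leq_mul.
have h6 : N * N * 1 <= N * N * N by rewrite leq_mul.
have h7 : N * 1 <= N * N by rewrite leq_mul.
have h8 : (G * 1) * (N * N * N) <= (G * G) * (N * N * N).
  by rewrite !leq_mul //; lia.
have h9 : G * 1 <= G * (N * N * N) by rewrite leq_mul //; lia.
have h10 : 1 * (N * N * N) <= G * (N * N * N) by rewrite leq_mul //; lia.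
have -> : 400 * (G * G) * (N * N * N) = 400 * ((G * G) * (N * N * N)) by lia.
have E : N * (G * (228 * (G * (N * N)))) = 228 * ((G * G) * (N * N * N)) by lia.
rewrite mulnDr; lia.
Qed.

(** On the empty digraph the program still has to run, while [#|D| ^ c] would be 0 for positive [c];
    hence [maxn 1]. *)
Theorem theorem4p4 :
  exists (P : program) (f : nat -> nat) (c : nat),
    computable f /\
    forall (D : digraph) (k : nat), 0 < k ->
      outputs_within P (encode D k) (f k * maxn 1 #|D| ^ c) (k <= ell D).
Proof.
exists (compile 0 (setup_cmd ;; search_cmd)), (fun k => 400 * 2 ^ (4 * k)), 3.
split=> [|D k k_gt0]; first exact: computable_exp.
apply: runs_outputs; apply: runs_le (time_bound _ k_gt0); apply: runs_seq.
apply: runs_post (runs_setup D k) _ => m [em mS mG].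
by apply: runs_post (runs_search em mS mG) _ => m' ->; rewrite has_accepts.
Qed.
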